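(* Let $J$ be a semi-infinite Jacobi matrix with Jacobi parameters $\{a_n,b_n\}_{n=1}^\infty$ ($a_n>0$, $b_n\in\mathbb{R}$), and suppose $$\limsup_{n\to\infty}\,(|a_n^2-1|+|b_n|)^{1/2n}=R^{-1}<1 .$$ Let $u$ be the Jost function of $J$ and $B(z)=1-\sum_{n=0}^\infty[b_{n+1}z^{2n+1}+(a_{n+1}^2-1)z^{2n+2}]$. Then $$(1-z^2)\,u(z)+z^2\,\overline{u(1/\bar z)}\,B(z)$$ is analytic in $\{z: R^{-1}<|z|<R^2\}$; that is, this function, defined near the unit circle, extends to an analytic function on that annulus.
   Context: Jacobi matrix: $J$ is the tridiagonal matrix on $\ell^2(\{1,2,\dots\})$ with diagonal entries $b_n$ and off-diagonal entries $a_n$ ($a_n>0$, $b_n\in\mathbb{R}$). Its spectral measure $\gamma$ is the spectral measure of $J$ for the vector $\delta_1=(1,0,0,\dots)^t$. $\mathbb{D}=\{z:|z|<1\}$. (If the limsup is $0$, $R=\infty$.) Jost function: when the Jacobi parameters decay exponentially ($\limsup_n(|b_n|+|a_n-1|)^{1/n}<1$), the Jost function $u$ is the function analytic in a neighborhood of $\overline{\mathbb{D}}$ determined by: (i) for $z\in\mathbb{D}$, $u(z)=0$ iff $z+z^{-1}$ is an eigenvalue of $J$ (these zeros are simple); (ii) the singular part of $\gamma$ is supported on a finite set of eigenvalues in $\mathbb{R}\setminus[-2,2]$, and $d\gamma\restriction[-2,2]=f(x)\,dx$ with $f(2\cos\theta)=\frac1\pi\,\frac{\sin\theta}{|u(e^{i\theta})|^2}$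 for $\theta\in[0,\pi]$; (iii) $u(0)>0$. Equivalently, for $z\in\mathbb{D}$, $u(z)=\left(\prod_{j=1}^\infty a_j\right)^{-1}\det\left(1+\delta J\,(J_0-(z+z^{-1}))^{-1}\right)$, where $J_0$ is the Jacobi matrix with $a_n\equiv1,b_n\equiv0$ and $\delta J=J-J_0$. Since $u$ is real on the real axis, $\overline{u(\bar z)}=u(z)$. *)

(* Defs.v *)
From HB Require Import structures.
From mathcomp Require Import all_boot all_order all_algebra.
From mathcomp Require Import all_classical all_reals all_analysis.
From mathcomp Require Import complex.

Set Implicit Arguments.
Unset Strict Implicit.
Unset Printing Implicit Defensive.

Import Order.TTheory GRing.Theory Num.Theory.
Import numFieldNormedType.Exports.

Local Open Scope classical_set_scope.
Local Open Scope ring_scope.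
Local Open Scope complex_scope.

(* R[i] packed as a numClosedFieldType, so that it gets the norm topology
   which MathComp-Analysis puts on every numFieldType. *)
Definition Cplx (R : realType) : numClosedFieldType := R[i].

(* All sequences are indexed from 0: a n, b n and v n stand for a_{n+1},
   b_{n+1} and v_{n+1}. *)

Definition analytic_at (R : realType) (f : Cplx R -> Cplx R) (z0 : Cplx R)
    : Prop :=
  exists c : nat -> Cplx R,
    \forall z \near z0, series (fun n => c n * (z - z0) ^+ n) @ \oo --> f z.

Definition l2 (R : realType) (v : nat -> Cplx R) : Prop :=
  cvgn (series (fun n => `|v n| ^+ 2)).

Definition basis_vec (R : realType) (j : nat) : nat -> Cplx R :=
  fun n => (n == j)%:R.

(* (J v)_n = a_{n-1} v_{n-1} + b_n v_n + a_n v_{n+1}, with no first term in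
   the first row. *)
Definition jacobi (R : realType) (a b : nat -> R) (v : nat -> Cplx R)
    : nat -> Cplx R :=
  fun n => (if n is m.+1 then (a m)%:C * v m else 0)
           + (b n)%:C * v n + (a n)%:C * v n.+1.

Definition free_jacobi (R : realType) : (nat -> Cplx R) -> nat -> Cplx R :=
  jacobi (fun=> 1) (fun=> 0).

Definition delta_jacobi (R : realType) (a b : nat -> R) (v : nat -> Cplx R)
    : nat -> Cplx R :=
  jacobi a b v - free_jacobi v.

(* (H - E)^{-1} w: the v in l^2 with (H - E) v = w, which is unique when E is
   in the resolvent set of H. *)
Definition resolvent (R : realType) (H : (nat -> Cplx R) -> nat -> Cplx R)
    (E : Cplx R) (w : nat -> Cplx R) : nat -> Cplx R :=
  get [set v : nat -> Cplx R | l2 v /\ (forall n, H v n - E * v n = w n)].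

(* det(1 + A) for a trace class operator A on l^2, as the limit of
   det(1 + P_n A P_n), where P_n is the projection on the first n basis vectors
   (P_n A P_n tends to A in trace norm). *)
Definition fredholm_det (R : realType) (A : (nat -> Cplx R) -> nat -> Cplx R)
    : Cplx R :=
  limn (fun n : nat =>
    \det (1%:M + \matrix_(i < n, j < n) A (@basis_vec R j) i) : Cplx R).

(* u is analytic in a neighborhood of the closed unit disk, and for z in the
   open disk u(z) = (prod_j a_j)^{-1} det(1 + (J - J_0)(J_0 - (z + 1/z))^{-1});
   the value at z = 0, where 1/z has no meaning, is fixed by continuity. *)
Definition is_jost_function (R : realType) (a b : nat -> R)
    (u : Cplx R -> Cplx R) : Prop :=
  (forall z : Cplx R, Normc.normc z <= 1 -> analytic_at u z) /\
  (forall z : Cplx R, z != 0 -> Normc.normc z < 1 ->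
     u z = (limn (fun n : nat => \prod_(j < n) a j))^-1%:C
           * fredholm_det (fun v =>
               delta_jacobi a b (resolvent (@free_jacobi R) (z + z^-1) v))).

Definition B_fun (R : realType) (a b : nat -> R) (z : Cplx R) : Cplx R :=
  1 - limn (series (fun n : nat =>
        (b n)%:C * z ^+ (2 * n + 1) + (a n ^+ 2 - 1)%:C * z ^+ (2 * n + 2)
        : Cplx R)).

(* Main.v *)
Require Import Defs.
From HB Require Import structures.
From mathcomp Require Import all_boot all_order all_algebra.
From mathcomp Require Import all_classical all_reals all_analysis.
From mathcomp Require Import complex.
From mathcomp Require Import ring lra zify.

Set Implicit Arguments.
Unset Strict Implicit.
Unset Printing Implicit Defensive.

Import Order.TTheory GRing.Theory Num.Theory.
Import numFieldNormedType.Exports.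

Local Open Scope classical_set_scope.
Local Open Scope ring_scope.

(** Write d_n(x) = (1 - a_n^2) x^2 - b_n x, and let C_n, G_n be the
    Geronimo-Case polynomials: C_0 = G_0 = 1 and
<<
      C_(n+1) = (x^2 - b_n x) C_n + G_n,    G_(n+1) = G_n + d_n C_n.
>>
    Up to the factor x^n, C_n is the n-th monic orthogonal polynomial at
    x + 1/x, and the Jost function is u = kappa G with G = lim G_n and
    kappa = 1 / prod a_j.  To see this, the truncated determinants that define
    u are computed exactly: below the diagonal the free Green function is
    proportional to the decaying solution x^k, so the compression of
    1 + (J - J_0)(J_0 - E)^-1 to n coordinates is a product of one tridiagonal
    matrix and the inverse of another, each with a modified corner.  Its
    determinant is C_n - a_(n-1) x^2 C_(n-1), which differs from G_n by a term
    that tends to 0 when |x| < 1 ([fredholm_minor], [fredholm_det_gcG_lim]).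

    Since G = 1 + sum d_n C_n and B(z) = 1 + sum d_n(z) z^(2n), and since C_n
    is palindromic, C_n(z) = z^(2n) C_n(1/z), the two series combine near the
    unit circle into
<<
      (1 - z^2) G(z) + z^2 G(1/z) B(z) =
        (1 - z^2) + z^2 G(1/z) + sum d_n(z) z^(2n+2) E_n(1/z),
      E_n(w) = G(w) - (1 - w^2) C_n(w).
>>
    The gain is in E_n.  Let p be slightly larger than 1/R, so that d_n is of
    order p^(2n).  The difference D_n = G_n - (1 - w^2) C_n satisfies
    D_(n+1) = w^2 (D_n + ((1 - a_n^2) - b_n w) C_n), so E_n(w) decays like the
    n-th power of max(|w|^2, p^2), up to a factor arbitrarily close to 1 per
    step; with w = 1/z the terms of the series are of order
    max(p^2, p^4 |z|^2)^n.  The series therefore converges as long as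
    p^2 |z| < 1, while G(1/z) makes sense for |z| > p.  Letting p tend to 1/R
    gives the whole annulus, and the right-hand side above is the required
    continuation ([extension], [extensionE]).

    Analyticity of the limits is obtained without contour integrals.  All
    functions are built from z and 1/z by sums, products and limits, and these
    operations are controlled in the Banach algebra of power series around z0
    with absolutely summable coefficients at radius r ([expands]); there z has
    norm |z0| + r and 1/z has norm 1 / (|z0| - r), so the pointwise estimates
    above are also estimates in the algebra once r is small.  Outside the
    closed disk u is only known through its Taylor series at the points of the
    circle, whence the appeal to the identity theorem ([identity_theorem]). *)

Local Notation normc := Normc.normc.
Local Arguments Normc.normc : simpl never.
Local Notation "x %:C" := (real_complex _ x).


(** * Norms and dominated series of complex numbers *)

Section ComplexNorm.
Variable R : realType.
Implicit Types (x y z l : Cplx R) (u v : nat -> Cplx R).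

Lemma normE z : `|z| = (normc z)%:C. Proof. by []. Qed.
Lemma normc_ge0 z : 0 <= normc z.
Proof. by rewrite -(@lecR R) -normE normr_ge0. Qed.
Lemma normcM z y : normc (z * y) = normc z * normc y.
Proof. exact: Normc.normcM. Qed.
Lemma normcD z y : normc (z + y) <= normc z + normc y.
Proof. exact: le_normcD. Qed.
Lemma normcN z : normc (- z) = normc z.
Proof. exact: normcN. Qed.
Lemma normcV z : normc z^-1 = (normc z)^-1.
Proof. exact: Normc.normcV. Qed.
Lemma normcC z y : normc (z - y) = normc (y - z).
Proof. by rewrite -normcN opprB. Qed.
Lemma normc_eq0 z : (normc z == 0) = (z == 0).
Proof. by apply/eqP/eqP => [/Normc.eq0_normc//|->]; exact: Normc.normc0. Qed.
Lemma normc0 : normc (0 : Cplx R) = 0. Proof. exact: Normc.normc0. Qed.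
Lemma normc1 : normc (1 : Cplx R) = 1. Proof. exact: Normc.normc1. Qed.
Lemma normcX z n : normc (z ^+ n) = normc z ^+ n.
Proof. by elim: n => [|n IH]; rewrite ?normc1// !exprS normcM IH. Qed.
Lemma normc_real (t : R) : normc (t%:C : Cplx R) = `|t|.
Proof. by rewrite /normc /= expr0n /= addr0 sqrtr_sqr. Qed.
Lemma normc_gt0 z : (0 < normc z) = (z != 0).
Proof. by rewrite lt_def normc_ge0 andbT normc_eq0. Qed.
Lemma normc_sum (I : Type) (s : seq I) (P : pred I) (F : I -> Cplx R) :
  normc (\sum_(i <- s | P i) F i) <= \sum_(i <- s | P i) normc (F i).
Proof.
elim/big_ind2: _ => [|x p y q hx hy|//]; first by rewrite normc0.
by apply: (le_trans (normcD _ _)); exact: lerD.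
Qed.

Lemma normc_conj z : normc z^* = normc z.
Proof. by apply: (@complexI R); rewrite -!normE norm_conjC. Qed.
Lemma conj_real (t : R) : (t%:C : Cplx R)^* = t%:C.
Proof. exact: conjc_real. Qed.

(** Convergence of complex sequences is reduced to real ones, since
    completeness and dominated convergence of series are available there. *)
Lemma cvg_normcP u l :
  u @ \oo --> l <-> (fun n => normc (u n - l)) @ \oo --> (0 : R).
Proof.
split => H.
  apply/cvgrPdist_lt => e e0; move/cvgrPdist_lt: H => /(_ e%:C).
  rewrite (@ltcR R 0 e) => /(_ e0); apply: filterS => n; rewrite normE ltcR normcC.
  by rewrite sub0r normrN ger0_norm// normc_ge0.
apply/cvgrPdist_lt => e e0.
have e_real : e = (complex.Re e)%:C.
  by case: e e0 => ? ?; rewrite ltcE /= => /andP[/eqP -> _].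
move: e0; rewrite e_real (@ltcR R 0) => e0.
move/cvgrPdist_lt: H => /(_ _ e0); apply: filterS => n.
by rewrite normE ltcR normcC sub0r normrN ger0_norm// normc_ge0.
Qed.

Lemma near_normcP z0 (P : Cplx R -> Prop) :
  (\forall z \near z0, P z) <->
  exists2 e : R, 0 < e & forall z, normc (z - z0) < e -> P z.
Proof.
split.
  move=> /nbhs_ballP[e /= e0 He].
  have e_real : e = (complex.Re e)%:C.
    by case: e e0 {He} => ? ?; rewrite ltcE /= => /andP[/eqP -> _].
  move: e0 He; rewrite e_real (@ltcR R 0) => e0 He.
  exists (complex.Re e) => // z hz; apply: He.
  by rewrite /ball /= normE ltcR normcC.
move=> [e e0 He]; apply/nbhs_ballP; exists e%:C => /=.
  by rewrite (@ltcR R 0).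
by move=> z; rewrite /ball /= normE ltcR normcC => /He.
Qed.

Lemma cvg_normc u l : u @ \oo --> l -> (fun n => normc (u n)) @ \oo --> normc l.
Proof.
move=> /cvg_normcP H; apply/cvgrPdist_le => e e0.
move/cvgrPdist_le: H => /(_ _ e0); apply: filterS => n.
rewrite sub0r normrN ger0_norm ?normc_ge0// => h.
rewrite ler_norml; apply/andP; split;
  [have := normcD (u n - l) l|have := normcD (l - u n) (u n)].
  by rewrite subrK; lra.
by rewrite subrK (normcC l); lra.
Qed.

Lemma le_cvg_normc u l (M : R) :
  u @ \oo --> l -> (\forall n \near \oo, normc (u n) <= M) -> normc l <= M.
Proof.
move=> /cvg_normc H h; rewrite -(cvg_lim _ H)//; apply: limr_le => //.
by apply/cvg_ex; exists (normc l).
Qed.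

(** The explicit remainder S - series M n is what makes the interchange of
    two summations in [expands_series] quantitative. *)
Lemma cvg_series_majorant (u : nat -> Cplx R) (M : nat -> R) (S : R) :
  (forall n, normc (u n) <= M n) -> series M @ \oo --> S ->
  exists l, series u @ \oo --> l /\
    forall n, normc (l - series u n) <= S - series M n.
Proof.
move=> uM MS.
have re_le z : `|complex.Re z| <= normc z.
  by case: z => x y; rewrite /normc /= -sqrtr_sqr ler_wsqrtr// lerDl sqr_ge0.
have im_le z : `|complex.Im z| <= normc z.
  by case: z => x y; rewrite /normc /= -sqrtr_sqr ler_wsqrtr// lerDr sqr_ge0.
have cR (f : Cplx R -> R) : (forall z, `|f z| <= normc z) ->
    cvgn (series (fun n => f (u n))).
  move=> hf; apply: normed_cvg.
  apply: (@series_le_cvg _ _ M) => [n|n|n|].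
  - exact: normr_ge0.
  - exact: le_trans (normc_ge0 _) (uM n).
  - exact: le_trans (hf _) (uM n).
  - by apply/cvg_ex; exists S.
have /cvg_ex[x hx] := cR _ re_le.
have /cvg_ex[y hy] := cR _ im_le.
have hl : series u @ \oo --> (Complex x y : Cplx R).
  apply/cvg_normcP.
  have h2 : (fun n => `|series (fun n => complex.Re (u n)) n - x| +
       `|series (fun n => complex.Im (u n)) n - y|) @ \oo --> (0 : R).
    rewrite -[X in _ --> X]addr0 -{1}(@normr0 _ R) -{2}(@normr0 _ R).
    rewrite -{1}(subrr x) -(subrr y).
    apply: cvgD; apply: cvg_norm; apply: cvgB => //; exact: cvg_cst.
  apply: (squeeze_cvgr _ (cvg_cst (0 : R)) h2).
  apply: nearW => n; rewrite normc_ge0 /=.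
  have -> : series u n = Complex (series (fun n => complex.Re (u n)) n)
                          (series (fun n => complex.Im (u n)) n).
    rewrite /series /=; elim: n  => [|n IH]; first by rewrite !big_geq.
    by rewrite !big_nat_recr//= IH; case: (u n).
  set p := series _ _; set q := series _ _.
  have -> : (Complex p q : Cplx R) - Complex x y = (p - x)%:C + 'i%C * (q - y)%:C.
    by apply/eqP; rewrite eq_complex /=; apply/andP; split; apply/eqP; ring.
  apply: (le_trans (normcD _ _)); rewrite normcM !normc_real lerD2l.
  by rewrite /normc /= expr0n /= add0r expr1n sqrtr1 mul1r.
exists (Complex x y); split=> // n.
have h1 : (fun m => series u m - series u n) @ \oo --> (Complex x y : Cplx R) - series u n.
  exact: (cvgB hl (cvg_cst _)).
apply: (le_cvg_normc h1); exists n => // m /= nm.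
have ndM : nondecreasing_seq (series M).
  apply/nondecreasing_series => k _ _; exact: le_trans (normc_ge0 _) (uM k).
have : normc (series u m - series u n) <= series M m - series M n.
  rewrite !sub_series_geq//; apply: (le_trans (normc_sum _ _ _)).
  by apply: ler_sum => i _; exact: uM.
move=> /le_trans; apply; rewrite lerD2r.
rewrite -(cvg_lim _ MS)//; apply: nondecreasing_cvgn_le => //.
by apply/cvg_ex; exists S.
Qed.
End ComplexNorm.

(** * Power series with summable coefficients *)

Section Expansion.
Variable R : realType.
Implicit Types (z l : Cplx R) (f g : Cplx R -> Cplx R) (r M S : R).

(** The condition bounds by M the norm of f in the Banach algebra of power
    series around z0 that converge absolutely on the closed disk of radius r. *)
Definition expands (z0 : Cplx R) r M f := exists c : nat -> Cplx R,
  (forall N, \sum_(k < N) normc (c k) * r ^+ k <= M) /\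
  forall z, normc (z - z0) <= r ->
    series (fun k => c k * (z - z0) ^+ k) @ \oo --> f z.

Lemma seriesE (V : zmodType) (u : nat -> V) n : series u n = \sum_(k < n) u k.
Proof. by rewrite /series /= big_mkord. Qed.

Lemma eq_cvgn (T : topologicalType) (u v : nat -> T) (l : T) : (forall n, u n = v n) ->
  u @ \oo --> l -> v @ \oo --> l.
Proof. by move=> /funext ->. Qed.

Lemma cvgn_sum_ord (K : numFieldType) (F : nat -> nat -> K) (l : nat -> K) n :
  (forall k, F k @ \oo --> l k) ->
  (fun m => \sum_(k < n) F k m) @ \oo --> \sum_(k < n) l k.
Proof.
move=> Fl; elim: n => [|n IH].
  by apply: eq_cvgn (cvg_cst _) => m; rewrite !big_ord0.
rewrite big_ord_recr; apply: eq_cvgn (cvgD IH (Fl n)) => m.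
by rewrite big_ord_recr.
Qed.

Variables (z0 : Cplx R) (r : R).
Hypothesis r_gt0 : 0 < r.

Lemma expands_ge0 M f : expands z0 r M f -> 0 <= M.
Proof. by case=> c [/(_ 0)]; rewrite big_ord0. Qed.

Lemma expands_eq M f g : (forall z, normc (z - z0) <= r -> f z = g z) ->
  expands z0 r M f -> expands z0 r M g.
Proof.
by move=> fg [c [cM cf]]; exists c; split=> [//|z zr]; rewrite -(fg _ zr); exact: cf.
Qed.

Lemma expands_le M M' f : M <= M' -> expands z0 r M f -> expands z0 r M' f.
Proof.
by move=> MM' [c [cM cf]]; exists c; split=> [N|]; [exact: le_trans (cM N) MM'|exact: cf].
Qed.

Lemma expands_analytic M f : expands z0 r M f -> analytic_at f z0.
Proof.
move=> [c [_ cf]]; exists c; apply/near_normcP; exists r => // z /ltW; exact: cf.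
Qed.

Lemma expands_norm M f z : normc (z - z0) <= r -> expands z0 r M f ->
  normc (f z) <= M.
Proof.
move=> zr [c [cM cf]]; apply: (le_cvg_normc (cf z zr)); apply: nearW => n.
rewrite seriesE; apply: (le_trans (normc_sum _ _ _)); apply: le_trans (cM n).
apply: ler_sum => k _; rewrite normcM normcX ler_wpM2l ?normc_ge0//.
by rewrite lerXn2r ?nnegrE ?normc_ge0// ltW.
Qed.

Lemma expands_cst l : expands z0 r (normc l) (fun=> l).
Proof.
exists (fun k => if k is 0 then l else 0); split=> [[|N]|z zr].
- by rewrite big_ord0 normc_ge0.
- rewrite big_ord_recl /= expr0 mulr1 big1 ?addr0// => i _.
  by rewrite normc0 mul0r.
- apply/cvg_normcP; apply: (@cvg_trans _ (cst (0 : R) @ \oo)); last exact: cvg_cst.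
  apply: near_eq_cvg; exists 1 => // -[|n] //= _.
  rewrite seriesE big_ord_recl /= expr0 mulr1 big1 => [|i _]; last by rewrite mul0r.
  by rewrite addr0 subrr normc0.
Qed.

Lemma expandsD M M' f g : expands z0 r M f -> expands z0 r M' g ->
  expands z0 r (M + M') (fun z => f z + g z).
Proof.
move=> [c [cM cf]] [d [dM dg]]; exists (fun k => c k + d k); split=> [N|z zr].
  apply: le_trans (lerD (cM N) (dM N)); rewrite -big_split /=.
  apply: ler_sum => k _; rewrite -mulrDl ler_wpM2r ?normcD//.
  by rewrite exprn_ge0// ltW.
apply: eq_cvgn (cvgD (cf z zr) (dg z zr)) => n.
by rewrite !fctE !seriesE -big_split; apply: eq_bigr => k _; rewrite mulrDl.
Qed.

Lemma expandsZ M f l : expands z0 r M f -> expands z0 r (normc l * M) (fun z => l * f z).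
Proof.
move=> [c [cM cf]]; exists (fun k => l * c k); split=> [N|z zr].
  under eq_bigr do rewrite normcM -mulrA.
  by rewrite -mulr_sumr ler_wpM2l ?normc_ge0.
apply: eq_cvgn (cvgMl_tmp (a := l) (cf z zr)) => n.
by rewrite !seriesE mulr_sumr; apply: eq_bigr => k _; rewrite mulrA.
Qed.

Lemma expands_shift M f : expands z0 r M f ->
  expands z0 r (r * M) (fun z => (z - z0) * f z).
Proof.
move=> [c [cM cf]]; exists (fun k => if k is j.+1 then c j else 0); split=> [N|z zr].
  have M0 : 0 <= M by have := cM 0; rewrite big_ord0.
  case: N => [|N]; first by rewrite big_ord0 mulr_ge0// ltW.
  rewrite big_ord_recl normc0 mul0r add0r /=.
  under eq_bigr do rewrite /bump /= add1n exprS mulrCA.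
  rewrite -mulr_sumr; apply: ler_wpM2l; [exact: ltW|exact: cM].
rewrite -cvg_shiftS; apply: eq_cvgn (cvgMl_tmp (a := z - z0) (cf z zr)) => n /=.
rewrite !seriesE mulr_sumr big_ord_recl mul0r add0r /=.
by apply: eq_bigr => i _; rewrite /bump /= add1n exprS mulrCA.
Qed.

Lemma expandsX M f : expands z0 r M f ->
  expands z0 r ((normc z0 + r) * M) (fun z => z * f z).
Proof.
move=> h; have := expandsD (expandsZ z0 h) (expands_shift h).
rewrite -mulrDl; apply: expands_eq => z _; ring.
Qed.

(** Completeness of the algebra: the Taylor coefficients are summed
    termwise, and the tail bound for the majorant M controls the coefficients
    and the values at the same time.  It replaces the theorem that a locally
    uniform limit of analytic functions is analytic. *)
Lemma expands_series (f : nat -> Cplx R -> Cplx R) (M : nat -> R) S :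
  (forall n, expands z0 r (M n) (f n)) -> series M @ \oo --> S ->
  expands z0 r S (fun z => limn (series (fun n => f n z))).
Proof.
move=> hf MS.
have [c hc] := choice hf.
have M0 n : 0 <= M n by exact: expands_ge0 (hf n).
have leS n : series M n <= S.
  rewrite -(cvg_lim _ MS)//; apply: nondecreasing_cvgn_le.
    by apply/nondecreasing_series => k _ _.
  by apply/cvg_ex; exists S.
have cle n k : normc (c n k) * r ^+ k <= M n.
  have := (hc n).1 k.+1; rewrite big_ord_recr /=; apply: le_trans.
  by rewrite lerDr sumr_ge0// => i _; rewrite mulr_ge0 ?normc_ge0// exprn_ge0// ltW.
have /choice[e he] : forall k, exists l, series (c ^~ k) @ \oo --> l.
  move=> k.
  have h1 : series (fun n => M n / r ^+ k) @ \oo --> S / r ^+ k.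
    by apply: eq_cvgn (cvgMr_tmp (b := (r ^+ k)^-1) MS) => n; rewrite !seriesE mulr_suml.
  have h2 n : normc (c n k) <= M n / r ^+ k by rewrite ler_pdivlMr ?exprn_gt0.
  by have [l [hl _]] := cvg_series_majorant h2 h1; exists l.
(* The partial sums of the f_n are Cauchy in the norm of the algebra; a finite
   number of coefficients is kept so that the limit can be taken termwise. *)
have tail n0 N : \sum_(k < N) normc (e k - series (c ^~ k) n0) * r ^+ k <= S - series M n0.
  pose T m := \sum_(k < N) normc (series (c ^~ k) m - series (c ^~ k) n0) * r ^+ k.
  have hT : T @ \oo --> \sum_(k < N) normc (e k - series (c ^~ k) n0) * r ^+ k.
    apply: (@cvgn_sum_ord _ 
      (fun k m => normc (series (c ^~ k) m - series (c ^~ k) n0) * r ^+ k)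
      (fun k => normc (e k - series (c ^~ k) n0) * r ^+ k)) => k.
    exact: (cvgMr_tmp (cvg_normc (cvgB (he k) (cvg_cst _)))).
  rewrite -(cvg_lim _ hT)//; apply: limr_le; first by apply/cvg_ex; eexists; exact: hT.
  exists n0 => // m /= nm; rewrite /T.
  apply: (@le_trans _ _ (series M m - series M n0)); last by rewrite lerD2r.
  rewrite sub_series_geq//.
  rewrite (eq_bigr (fun k : 'I_N => normc (\sum_(n0 <= n < m) c n k) * r ^+ k)); last first.
    by move=> k _; rewrite sub_series_geq.
  apply: (@le_trans _ _ (\sum_(n0 <= n < m) \sum_(k < N) normc (c n k) * r ^+ k)); last first.
    by apply: ler_sum => n _; exact: (hc n).1.
  rewrite exchange_big /=; apply: ler_sum => k _; rewrite -mulr_suml.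
  apply: ler_wpM2r; [by rewrite exprn_ge0// ltW|exact: normc_sum].
exists e; split=> [N|z zr].
  have := tail 0 N; rewrite seriesE big_ord0 subr0; apply: le_trans.
  by apply: ler_sum => k _; rewrite seriesE big_ord0 subr0.
have [l [hl tl]] := cvg_series_majorant (fun n => expands_norm zr (hf n)) MS.
rewrite (cvg_lim _ hl)//.
apply/cvg_normcP/cvgrPdist_le => eps eps0.
have e3 : 0 < eps / 3 by rewrite divr_gt0.
have [n0 _ hn0] := (cvgrPdist_le _ _).1 MS _ e3.
have {hn0} hn0 : S - series M n0 <= eps / 3.
  by have := hn0 n0 (leqnn _); rewrite ger0_norm// subr_ge0.
have : (fun N => \sum_(n < n0) series (fun k => c n k * (z - z0) ^+ k) N) @ \oo -->
   series (fun n => f n z) n0.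
  rewrite seriesE; apply: (@cvgn_sum_ord _
    (fun n N => series (fun k => c n k * (z - z0) ^+ k) N) (f ^~ z)) => n.
  exact: (hc n).2.
move=> /cvg_normcP /cvgrPdist_le /(_ _ e3); apply: filterS => N.
rewrite !sub0r !normrN !ger0_norm ?normc_ge0// => hN.
set A := series _ N; set B := \sum_(n < n0) _ in hN; set Fn := series _ n0 in hN.
have -> : A - l = (A - B) + (B - Fn) - (l - Fn) by ring.
apply: (le_trans (normcD _ _)); rewrite normcN.
have h1 := normcD (A - B) (B - Fn).
have h2 := tl n0; rewrite -/Fn in h2.
suff h3 : normc (A - B) <= S - series M n0 by lra.
apply: le_trans (tail n0 N).
rewrite /A /B seriesE; under [X in _ - X]eq_bigr do rewrite seriesE.
rewrite exchange_big /= -sumrB; apply: (le_trans (normc_sum _ _ _)).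
apply: ler_sum => k _; rewrite -mulr_suml -mulrBl normcM normcX seriesE.
by rewrite ler_wpM2l ?normc_ge0// lerXn2r ?nnegrE ?normc_ge0// ltW.
Qed.

(** Geometric series 1/z = sum (z0 - z)^n / z0^(n+1); only multiplication by
    the variable and a convergent sum are involved. *)
Lemma expandsV M f : r < normc z0 -> expands z0 r M f ->
  expands z0 r ((normc z0 - r)^-1 * M) (fun z => z^-1 * f z).
Proof.
move=> rz0 hf; have n0 : 0 < normc z0 by exact: lt_trans rz0.
have z00 : z0 != 0 by rewrite -normc_gt0.
(* The n-th term of the geometric series for 1/z, times f. *)
pose g n z := z0^-1 * ((- z0^-1 * (z - z0)) ^+ n * f z).
have q1 : `|r / normc z0| < 1.
  by rewrite ger0_norm ?divr_ge0 ?ltW// ltr_pdivrMr// mul1r.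
have hg n : expands z0 r (geometric ((normc z0)^-1 * M) (r / normc z0) n) (g n).
  rewrite /geometric /= -mulrA -normcV [M * _]mulrC; apply: expandsZ.
  elim: n => [|n IH].
    by rewrite expr0 mul1r; apply: (expands_eq _ hf) => z _; rewrite expr0 mul1r.
  have := expandsZ (- z0^-1) (expands_shift IH).
  rewrite normcN [_ ^+ n.+1]exprS normcV !mulrA [_^-1 * r]mulrC.
  by apply: expands_eq => z _; rewrite [in RHS]exprS !mulrA.
have := expands_series hg (@cvg_geometric_series R _ _ q1).
have -> : (normc z0)^-1 * M / (1 - r / normc z0) = (normc z0 - r)^-1 * M.
  field. rewrite !gt_eqF// subr_gt0//.
apply: expands_eq => z zr.
have q2 : normc (- z0^-1 * (z - z0)) < 1.
  rewrite normcM normcN normcV mulrC ltr_pdivrMr// mul1r; exact: le_lt_trans rz0.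
have zn0 : z != 0.
  apply/eqP => ze; move: zr; rewrite ze sub0r normcN leNgt rz0//.
apply: cvg_lim => //.
have -> : z^-1 * f z = (z0^-1 * f z) / (1 - (- z0^-1 * (z - z0))).
  have -> : 1 - (- z0^-1 * (z - z0)) = z / z0 by field.
  by field; rewrite z00.
rewrite [X in series X](_ : _ = geometric (z0^-1 * f z) (- z0^-1 * (z - z0))); last first.
  by apply/funext => n; rewrite /g /=; ring.
rewrite geometric_seriesE; last first.
  by apply: contraTneq q2 => ->; rewrite normc1 ltxx.
set q := - z0^-1 * (z - z0).
have hq : (fun n => q ^+ n) @ \oo --> (0 : Cplx R).
  apply/cvg_normcP; under eq_fun do rewrite subr0 normcX.
  by apply: cvg_expr; rewrite ger0_norm ?normc_ge0.
apply: cvgMr_tmp; rewrite -[X in _ --> X]mulr1; apply: cvgMl_tmp.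
rewrite -[X in _ --> X]subr0; exact: (cvgB (cvg_cst _) hq).
Qed.

End Expansion.

(** * Determinants of Hessenberg matrices and the Geronimo-Case recursion *)

Section Hessenberg.
Variable K : comNzRingType.

Lemma sum_ord_delta n k (F : nat -> K) :
  \sum_(j < n) (if j == k :> nat then F j else 0) = if (k < n)%N then F k else 0.
Proof.
rewrite -big_mkcond /=; case: ltnP => [kn|nk].
  by rewrite (big_pred1 (Ordinal kn)).
by rewrite big1 // => i /eqP ik; have := ltn_ord i; rewrite ik ltnNge nk.
Qed.

(** Replacing the first column of T by T v does not change the determinant,
    because v starts with 1; the new column has a single nonzero entry, and
    deleting its row and column leaves a triangular matrix. *)
Lemma det_hessenberg n (T : 'M[K]_n.+1) (v : nat -> K) (q : K) :
  (forall i j : 'I_n.+1, (i.+1 < j)%N -> T i j = 0) -> v 0%N = 1 ->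
  (forall i : 'I_n.+1, \sum_j T i j * v j = if i == n :> nat then q else 0) ->
  \det T = (-1) ^+ n * q * \prod_(i < n) T (widen_ord (leqnSn n) i) (lift ord0 i).
Proof.
move=> Thess v0 Tv.
(* S replaces the first basis vector by v, so that T S has first column T v. *)
pose S : 'M[K]_n.+1 := \matrix_(i, j) (if j == 0%N :> nat then v i else (i == j)%:R).
have detS : \det S = 1.
  rewrite det_trig.
    rewrite big_ord_recl big1 ?mulr1 => [|i _]; rewrite mxE //=.
    by rewrite eqxx.
  apply/is_trig_mxP => i j ij; rewrite mxE.
  have -> : (j == 0%N :> nat) = false by rewrite gtn_eqF// (leq_ltn_trans _ ij).
  by have -> : (i == j) = false by apply/eqP => e; rewrite e ltnn in ij.
have TS0 i : (T *m S) i ord0 = if i == n :> nat then q else 0.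
  by rewrite mxE -Tv; apply: eq_bigr => j _; rewrite mxE.
have TSS i j : (T *m S) i (lift ord0 j) = T i (lift ord0 j).
  rewrite mxE (bigD1 (lift ord0 j)) //= mxE /= eqxx mulr1 big1 ?addr0// => k kj.
  by rewrite mxE /= (negbTE kj) mulr0.
have -> : \det T = \det (T *m S) by rewrite det_mulmx detS mulr1.
rewrite (expand_det_col _ ord0) (bigD1 ord_max) //=.
rewrite big1 ?addr0; last first.
  move=> i ni; rewrite TS0; case: eqP => [e|]; last by rewrite mul0r.
  by case/negP: ni; apply/eqP/val_inj.
rewrite TS0 eqxx /cofactor /= addn0 mulrCA mulrA; congr (_ * _).
rewrite det_trig.
  apply: eq_bigr => i _; rewrite mxE mxE TSS; congr (T _ _).
  by apply: val_inj; rewrite /= /bump leqNgt ltn_ord.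
apply/is_trig_mxP => i j ij; rewrite mxE mxE TSS Thess//.
by rewrite /= /bump [(n <= i)%N]leqNgt ltn_ord /= add0n add1n ltnS.
Qed.
End Hessenberg.

Section GeronimoCase.
Variables (R : realType) (a b : nat -> R).
Implicit Types x z : Cplx R.

(** Both sequences are computed together; the second is the Jost function of
    the matrix whose coefficients are replaced by the free ones from rank n on,
    up to the product of the a_j. *)
Fixpoint geronimo_case (n : nat) x : Cplx R * Cplx R :=
  if n is m.+1 then
    let: (c, g) := geronimo_case m x in
    ((x ^+ 2 - (b m)%:C * x) * c + g,
     g + ((1 - a m ^+ 2)%:C * x ^+ 2 - (b m)%:C * x) * c)
  else (1, 1).

Definition gcC n x := (geronimo_case n x).1.
Definition gcG n x := (geronimo_case n x).2.
Definition gc_coef n x : Cplx R := (1 - a n ^+ 2)%:C * x ^+ 2 - (b n)%:C * x.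

Lemma gcCS n x : gcC n.+1 x = (x ^+ 2 - (b n)%:C * x) * gcC n x + gcG n x.
Proof. by rewrite /gcC /gcG /=; case: geronimo_case. Qed.
Lemma gcGS n x : gcG n.+1 x = gcG n x + gc_coef n x * gcC n x.
Proof. by rewrite /gcC /gcG /=; case: geronimo_case. Qed.

Lemma gcGE n x : gcG n.+1 x = gcC n.+1 x - (a n ^+ 2)%:C * x ^+ 2 * gcC n x.
Proof.
by rewrite gcGS gcCS /gc_coef rmorphB rmorph1; ring.
Qed.

Lemma gcC_rec n x : gcC n.+2 x =
  (x ^+ 2 + 1 - (b n.+1)%:C * x) * gcC n.+1 x - (a n ^+ 2)%:C * x ^+ 2 * gcC n x.
Proof. by rewrite gcCS gcGE; ring. Qed.

(** The three-term recurrence is invariant under x -> 1/x up to the factor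
    x^2, as the orthogonal polynomials depend on x + 1/x only. *)
Lemma gcC_palindrome n x : x != 0 -> gcC n x = x ^+ (2 * n) * gcC n x^-1.
Proof.
move=> x0; suff : gcC n x = x ^+ (2 * n) * gcC n x^-1 /\
    gcC n.+1 x = x ^+ (2 * n.+1) * gcC n.+1 x^-1 by case.
elim: n => [|n [IH1 IH2]].
  split; first by rewrite muln0 mul1r.
  by rewrite !gcCS /gcC /gcG /= !mulr1; field.
split=> //; rewrite !gcC_rec IH1 IH2.
rewrite (_ : 2 * n.+2 = (2 * n) + 4)%N 1?(_ : 2 * n.+1 = (2 * n) + 2)%N; [|lia..].
by rewrite !exprD; field.
Qed.
End GeronimoCase.

(** * The resolvent of the free Jacobi matrix *)

Section FreeResolvent.
Variable R : realType.
Implicit Types (z : Cplx R) (v w : nat -> Cplx R).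

(** The value at (z + 1/z) / 2 of the Chebyshev polynomial U_(m-1), in closed
    form. *)
Definition free_sol z m : Cplx R := (z^-1 ^+ m - z ^+ m) / (z^-1 - z).

(** The usual product of the solution regular at 0 with the decaying one;
    indices are shifted by one as the rows are numbered from 0. *)
Definition green z j k : Cplx R := - free_sol z (minn j k).+1 * z ^+ (maxn j k).+1.

Variable z : Cplx R.
Hypotheses (z_neq0 : z != 0) (z_lt1 : normc z < 1).

Let zV_neq : z^-1 - z != 0.
Proof.
rewrite subr_eq0; apply/eqP => e; have : normc z * normc z = 1.
  by rewrite -{1}e -normcM mulVf// normc1.
have := normc_ge0 z; move: z_lt1; nra.
Qed.

Lemma free_sol0 : free_sol z 0 = 0.
Proof. by rewrite /free_sol !expr0 subrr mul0r. Qed.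

Lemma free_solS m : free_sol z m.+2 = (z + z^-1) * free_sol z m.+1 - free_sol z m.
Proof.
rewrite /free_sol !mulrA -mulrBl; congr (_ / _).
by rewrite !exprS; field.
Qed.

Lemma free_sol_wronskian m : (free_sol z m.+1 - z * free_sol z m) * z ^+ m = 1.
Proof.
rewrite /free_sol mulrA -mulrBl mulrAC; apply: (mulIf zV_neq).
rewrite divfK// mul1r exprVn -exprVn !exprS mulrBl.
have e : z^-1 ^+ m * z ^+ m = 1 by rewrite -exprMn mulVf// expr1n.
transitivity ((z^-1 - z) * (z^-1 ^+ m * z ^+ m)); first ring.
by rewrite e mulr1.
Qed.

Lemma greenP j k :
  free_jacobi (green z j) k - (z + z^-1) * green z j k = @basis_vec R j k.
Proof.
rewrite /free_jacobi /jacobi rmorph0 rmorph1 mul0r addr0 mul1r.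
have -> : (if k is m.+1 then 1 * green z j m else 0) =
    - free_sol z (minn j.+1 k) * z ^+ (maxn j.+1 k).
  case: k => [|m]; first by rewrite minn0 free_sol0 oppr0 mul0r.
  by rewrite mul1r /green minnSS maxnSS.
rewrite /green /basis_vec.
case: (ltngtP k j) => [kj|jk|->].
- have -> : minn j.+1 k = k by lia.
  have -> : maxn j.+1 k = j.+1 by lia.
  have -> : minn j k.+1 = k.+1 by lia.
  have -> : maxn j k.+1 = j by lia.
  by rewrite free_solS mulr0n; ring.
- have -> : minn j.+1 k = j.+1 by lia.
  have -> : maxn j.+1 k = k by lia.
  have -> : minn j k.+1 = j by lia.
  have -> : maxn j k.+1 = k.+1 by lia.
  by rewrite mulr0n !exprS; field.
- have -> : minn j.+1 j = j by lia.
  have -> : maxn j.+1 j = j.+1 by lia.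
  have -> : minn j j.+1 = j by lia.
  have -> : maxn j j.+1 = j.+1 by lia.
  rewrite mulr1n -[RHS](free_sol_wronskian j.+1) free_solS !exprS; ring.
Qed.

(** Below the diagonal the Green function is a multiple of the decaying
    solution z^k; this is why truncating the matrices only changes a corner. *)
Lemma green_right j k : (j <= k)%N -> green z j k.+1 = z * green z j k.
Proof.
move=> jk; rewrite /green (minn_idPl jk) (maxn_idPr jk) (minn_idPl (leqW jk)).
by rewrite (maxn_idPr (leqW jk)) [in LHS]exprS; ring.
Qed.

Lemma green_l2 j : l2 (green z j).
Proof.
pose K := \sum_(m < j.+1) normc (free_sol z m.+1).
have K0 : 0 <= K by rewrite sumr_ge0// => i _; rewrite normc_ge0.
have gle k : normc (green z j k) <= K * normc z ^+ k.
  rewrite /green normcM normcN normcX; apply: ler_pM.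
  - exact: normc_ge0.
  - by rewrite exprn_ge0 ?normc_ge0.
  - have mj : (minn j k < j.+1)%N by rewrite ltnS geq_minl.
    rewrite /K (bigD1 (Ordinal mj)) //= lerDl sumr_ge0// => i _.
    exact: normc_ge0.
  - apply: ler_wiXn2l; [exact: normc_ge0|exact: ltW|].
    by rewrite leqW// leq_maxr.
have q1 : `|normc z ^+ 2| < 1.
  rewrite ger0_norm ?exprn_ge0 ?normc_ge0// expr_lt1 ?normc_ge0//.
have h k : normc (`|green z j k| ^+ 2 : Cplx R) <= geometric (K ^+ 2) (normc z ^+ 2) k.
  rewrite normE normcX normc_real ger0_norm ?normc_ge0// /geometric /=.
  rewrite -exprM mulnC exprM -exprMn lerXn2r ?nnegrE ?normc_ge0 ?mulr_ge0 ?exprn_ge0 ?normc_ge0//.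
have [l [hl _]] := cvg_series_majorant h (@cvg_geometric_series R _ _ q1).
by apply/cvg_ex; exists l.
Qed.

(** For a solution d of the homogeneous equation, d_(n+1) - z d_n is a
    geometric sequence of ratio 1/z, so it is unbounded unless d_0 = 0. *)
Lemma free_jacobi_l2_inj v w : l2 v -> l2 w ->
  (forall n, free_jacobi v n - (z + z^-1) * v n = free_jacobi w n - (z + z^-1) * w n) ->
  v = w.
Proof.
move=> vl2 wl2 vw; pose d n := v n - w n.
have bnd (u : nat -> Cplx R) : l2 u -> exists N, forall n, (N <= n)%N -> normc (u n) <= 1.
  move=> /cvg_series_cvg_0 /cvg_normcP /cvgrPdist_le /(_ _ ltr01)[N _ hN].
  exists N => n Nn; have := hN n Nn.
  rewrite sub0r normrN ger0_norm ?normc_ge0// subr0 normE normcX normc_real.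
  rewrite ger0_norm ?normc_ge0// => h.
  by rewrite -(@expr_le1 _ 2) ?normc_ge0.
have [N1 h1] := bnd _ vl2; have [N2 h2] := bnd _ wl2.
have d1 : d 1%N = (z + z^-1) * d 0%N.
  have := vw 0%N; rewrite /free_jacobi /jacobi /d rmorph0 rmorph1 !mul0r !mul1r !add0r.
  move=> h; apply/eqP; rewrite -subr_eq0; apply/eqP.
  rewrite -[RHS](subrr (w 1%N - (z + z^-1) * w 0%N)) -{1}h; ring.
have dS n : d n.+2 = (z + z^-1) * d n.+1 - d n.
  have := vw n.+1; rewrite /free_jacobi /jacobi /d rmorph0 rmorph1 !mul0r !mul1r !addr0.
  move=> h; apply/eqP; rewrite -subr_eq0; apply/eqP.
  rewrite -[RHS](subrr (w n + w n.+2 - (z + z^-1) * w n.+1)) -{1}h; ring.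
(* As d is bounded and |z| < 1, the left-hand side tends to 0. *)
have e n : z ^+ n.+1 * (d n.+1 - z * d n) = d 0%N.
  elim: n => [|n IH]; first by rewrite d1 expr1; field.
  by rewrite -IH dS !exprS; field.
have d0 : d 0%N = 0.
  apply/eqP; rewrite -normc_eq0 eq_le normc_ge0 andbT.
  have c : (fun n => normc z ^+ n * 4) @ \oo --> (0 * 4 : R).
    by apply: cvgMr_tmp; apply: cvg_expr; rewrite ger0_norm ?normc_ge0.
  rewrite -(mul0r (4 : R)) -(cvg_lim _ c)//; apply: limr_ge.
    by apply/cvg_ex; eexists; exact: c.
  exists (N1 + N2)%N => // n /= hn.
  rewrite -(e n) normcM normcX; apply: ler_pM.
  - by rewrite exprn_ge0// normc_ge0.
  - exact: normc_ge0.
  - by rewrite ler_wiXn2l ?normc_ge0// ltW.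
  have k1 := normcD (d n.+1) (- (z * d n)).
  have k2 := normcD (v n.+1) (- w n.+1).
  have k3 := normcD (v n) (- w n).
  rewrite !normcN normcM in k1 k2 k3; rewrite -!/(d _) in k2 k3.
  have N1n := leq_trans (leq_addr _ _) hn; have N2n := leq_trans (leq_addl _ _) hn.
  have l1 := h1 n N1n; have l2 := h1 n.+1 (leqW N1n).
  have l3 := h2 n N2n; have l4 := h2 n.+1 (leqW N2n).
  have k4 : normc z * normc (d n) <= normc (d n) by rewrite ler_piMl ?normc_ge0// ltW.
  lra.
have dn0 n : d n = 0 /\ d n.+1 = 0.
  elim: n => [|n [IH1 IH2]]; first by rewrite d1 d0 mulr0.
  by rewrite dS IH1 IH2 mulr0 subr0.
by apply/funext => n; apply/eqP; rewrite -subr_eq0; apply/eqP; exact: (dn0 n).1.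
Qed.

Lemma free_resolventE j :
  resolvent (@free_jacobi R) (z + z^-1) (@basis_vec R j) = green z j.
Proof.
have hg : l2 (green z j) /\
    forall n, free_jacobi (green z j) n - (z + z^-1) * green z j n = @basis_vec R j n.
  by split; [exact: green_l2|exact: greenP].
pose P := [set v : nat -> Cplx R | l2 v /\
  forall n, free_jacobi v n - (z + z^-1) * v n = @basis_vec R j n].
have [hl hr] := @getPex _ P (ex_intro P _ hg).
apply: (free_jacobi_l2_inj hl hg.1) => n.
by rewrite greenP; exact: hr.
Qed.
End FreeResolvent.

(** * Truncated Fredholm determinants *)

Section TruncatedJacobi.
Variables (R : realType).
Implicit Types (z E c : Cplx R) (a b : nat -> R) (g : nat -> Cplx R).

(** The truncation of J - E with c added to the last diagonal entry.  The
    corner c = a_n z accounts for the first coordinate that is cut off, on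
    vectors that are proportional to z^k from the last kept coordinate on. *)
Definition jacobi_corner a b n E c : 'M[Cplx R]_n.+1 := \matrix_(i, j)
  ((if j == i.+1 :> nat then (a i)%:C else 0) +
   (if j == i :> nat then (b i)%:C - E else 0) +
   (if i == j.+1 :> nat then (a j)%:C else 0) +
   (if j == n :> nat then if i == n :> nat then c else 0 else 0)).

Lemma jacobi_corner_mul a b n E c g (i : 'I_n.+1) :
  \sum_j jacobi_corner a b n E c i j * g j =
  jacobi a b g i - E * g i + (if i == n :> nat then c * g n - (a n)%:C * g n.+1 else 0).
Proof.
pose F1 j : Cplx R := (a i)%:C * g j.
pose F2 j : Cplx R := ((b i)%:C - E) * g j.
pose F3 j : Cplx R := (a j)%:C * g j.
pose F4 j : Cplx R := (if i == n :> nat then c else 0) * g j.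
rewrite (eq_bigr (fun j : 'I_n.+1 =>
  (if j == i.+1 :> nat then F1 j else 0) + (if j == i :> nat then F2 j else 0) +
  (if i == j.+1 :> nat then F3 j else 0) + (if j == n :> nat then F4 j else 0))); last first.
  by move=> j _; rewrite mxE !mulrDl; congr (_ + _ + _ + _); case: ifP; rewrite ?mul0r.
rewrite !big_split /= !sum_ord_delta ltn_ord ltnSn.
pose L : Cplx R := if i : nat is m.+1 then (a m)%:C * g m else 0.
have -> : \sum_(j < n.+1) (if i == j.+1 :> nat then F3 j else 0) = L.
  rewrite /L; have := ltn_ord i; case: (i : nat) => [|m] mn; first by rewrite big1.
  under eq_bigr do rewrite eqSS eq_sym.
  by rewrite sum_ord_delta ltnW.
have -> : jacobi a b g i = L + (b i)%:C * g i + (a i)%:C * g i.+1 by [].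
move: L => L; rewrite ltnS /F1 /F2 /F4.
have := ltn_ord i; rewrite ltnS leq_eqVlt => /orP[/eqP ->|lt_in].
  by rewrite eqxx ltnn; ring.
by rewrite lt_in (ltn_eqF lt_in); ring.
Qed.

(** [det_hessenberg] is applied to the vector of orthonormal polynomials at
    z + 1/z, which J - E annihilates except in the last row. *)
Lemma det_jacobi_corner a b n z : (forall k, 0 < a k) -> z != 0 ->
  \det (jacobi_corner a b n (z + z^-1) ((a n)%:C * z)) =
  (-1) ^+ n.+1 / z ^+ n.+1 * (gcC a b n.+1 z - (a n)%:C * z ^+ 2 * gcC a b n z).
Proof.
move=> a0 z0.
have an0 k : (a k)%:C != 0 :> Cplx R by rewrite -normc_gt0 normc_real normr_gt0 gt_eqF.
pose P k : Cplx R := \prod_(j < k) (a j)%:C.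
have P0 k : P k != 0 by apply/prodf_neq0 => i _; exact: an0.
have PS k : P k.+1 = P k * (a k)%:C by rewrite /P big_ord_recr.
(* The orthonormal polynomials at z + 1/z. *)
pose v k := gcC a b k z / (z ^+ k * P k).
have zk k : z ^+ k != 0 by rewrite expf_neq0.
have Jv k : jacobi a b v k - (z + z^-1) * v k = 0.
  case: k => [|k]; rewrite /jacobi /v.
    rewrite gcCS /gcC /gcG /= /P big_ord_recr !big_ord0 /=; field.
    by rewrite ?z0 ?an0.
  rewrite gcC_rec rmorphXn !PS !exprS /=; field.
  by rewrite ?z0 ?an0 ?zk ?P0.
rewrite (@det_hessenberg _ n _ v ((a n)%:C * (z * v n - v n.+1))).
- rewrite (eq_bigr (fun i : 'I_n => (a i)%:C)); last first.
    move=> i _; rewrite mxE /= /bump /= add1n eqxx.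
    have -> : (i.+1 == i) = false by rewrite gtn_eqF.
    have -> : (i == i.+2 :> nat) = false by rewrite ltn_eqF.
    by rewrite (ltn_eqF (ltn_ord i)) !addr0 if_same addr0.
  rewrite -/(P n) /v PS !exprS; field.
  by rewrite ?z0 ?an0 ?zk ?P0.
- move=> i j ij; rewrite mxE (gtn_eqF ij) (gtn_eqF (ltnW ij)).
  rewrite (ltn_eqF (leqW (ltnW ij))).
  have -> : (i == n :> nat) = false by have := ltn_ord j; lia.
  by rewrite if_same !addr0.
- by rewrite /v /P big_ord0 expr0 mulr1 divr1.
- move=> i; rewrite jacobi_corner_mul Jv add0r; case: ifP => // _.
  by ring.
Qed.

Lemma det_free_corner n z : z != 0 ->
  \det (jacobi_corner (fun=> 1) (fun=> 0) n (z + z^-1) z) = (-1) ^+ n.+1 / z ^+ n.+1.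
Proof.
move=> z0; have := @det_jacobi_corner (fun=> 1) (fun=> 0) n z (fun=> ltr01) z0.
rewrite !rmorph1 !mul1r => ->.
have -> : gcC (fun=> 1) (fun=> 0) n.+1 z - z ^+ 2 * gcC (fun=> 1) (fun=> 0) n z =
    gcG (fun=> 1) (fun=> 0) n.+1 z.
  by rewrite gcGE expr1n rmorph1 mul1r.
suff -> : gcG (fun=> 1) (fun=> 0) n.+1 z = 1 by rewrite mulr1.
elim: n.+1 => [//|m IH]; rewrite gcGS IH /gc_coef expr1n subrr !rmorph0.
by rewrite !mul0r subrr mul0r addr0.
Qed.

(** With G the truncated free Green function, T G is the wanted matrix and
    T_0 G is the identity, where T and T_0 are the cornered truncations for J
    and for J_0; so the minor is det T / det T_0. *)
Lemma fredholm_minor a b n z : (forall k, 0 < a k) -> z != 0 -> normc z < 1 ->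
  \det (1%:M + \matrix_(i < n.+1, j < n.+1)
     delta_jacobi a b (resolvent (@free_jacobi R) (z + z^-1) (@basis_vec R j)) i) =
  gcC a b n.+1 z - (a n)%:C * z ^+ 2 * gcC a b n z.
Proof.
move=> a0 z0 z1.
set M := (1%:M + _).
pose G : 'M[Cplx R]_n.+1 := \matrix_(i, j) green z j i.
have TG : jacobi_corner a b n (z + z^-1) ((a n)%:C * z) *m G = M.
  apply/matrixP => i j; rewrite !mxE.
  under eq_bigr do rewrite [G _ _]mxE.
  rewrite (jacobi_corner_mul _ _ _ _ (green z j)) free_resolventE//.
  rewrite green_right; last by rewrite -ltnS.
  rewrite [_%:C * (z * _)]mulrA subrr if_same addr0 /delta_jacobi.
  have -> : (i == j)%:R = free_jacobi (green z j) i - (z + z^-1) * green z j i.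
    by rewrite greenP.
  by rewrite !fctE; ring.
have T0G : jacobi_corner (fun=> 1) (fun=> 0) n (z + z^-1) z *m G = 1%:M.
  apply/matrixP => i j; rewrite !mxE.
  under eq_bigr do rewrite [G _ _]mxE.
  rewrite (jacobi_corner_mul _ _ _ _ (green z j)) green_right; last by rewrite -ltnS.
  by rewrite rmorph1 mul1r subrr if_same addr0 greenP.
have d0 := det_free_corner n z0.
have := congr1 determinant T0G; rewrite det1 det_mulmx d0 => dG.
rewrite -TG det_mulmx det_jacobi_corner// mulrAC dG mul1r.
by [].
Qed.
End TruncatedJacobi.

(** * Growth of the Geronimo-Case solutions *)

Section RealRecurrence.
Variable R : realType.
Implicit Types (q M K X Y L B : R) (u c d e : nat -> R).

Lemma eventually_geometric u q n0 : 0 < q -> (forall n, 0 <= u n) ->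
  (forall n, (n0 <= n)%N -> u n.+1 <= q * u n) ->
  exists2 M, 0 <= M & forall n, u n <= M * q ^+ n.
Proof.
move=> q0 u0 uq; pose M := \sum_(k < n0.+1) u k / q ^+ k.
have M0 : 0 <= M by apply: sumr_ge0 => k _; rewrite divr_ge0 ?exprn_ge0// ltW.
have small n : (n <= n0)%N -> u n <= M * q ^+ n.
  move=> nn0; rewrite -ler_pdivrMr ?exprn_gt0// /M.
  have nn0' : (n < n0.+1)%N by [].
  rewrite (bigD1 (Ordinal nn0')) //= lerDl sumr_ge0// => k _.
  by rewrite divr_ge0 ?exprn_ge0// ltW.
exists M => // n; elim: n => [|n IH]; first exact: small.
case: (leqP n.+1 n0) => [/small//|n0n].
rewrite exprS mulrCA; apply: le_trans (uq _ n0n) _.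
by rewrite ler_wpM2l// ltW.
Qed.

(** The forcing has ratio L > X, so it dominates the homogeneous solution. *)
Lemma geometric_forcing d X L B : 0 <= X -> X < L -> 0 <= B -> (forall n, 0 <= d n) ->
  (forall n, d n.+1 <= X * d n + B * L ^+ n) ->
  exists2 M, 0 <= M & forall n, d n <= M * L ^+ n.
Proof.
move=> X0 XL B0 d0 dS; have XL0 : 0 < L - X by rewrite subr_gt0.
have L0 : 0 <= L by lra.
exists (d 0%N + B / (L - X)); first by rewrite addr_ge0// divr_ge0// ltW.
set M := _ + _.
have BM : B <= (L - X) * M.
  rewrite /M mulrDr [X in _ + X]mulrC divfK ?gt_eqF// lerDr mulr_ge0// ltW//.
elim=> [|n IH].
  by rewrite expr0 mulr1 /M lerDl divr_ge0// ltW.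
apply: le_trans (dS n) _.
have Ln : 0 <= L ^+ n by exact: exprn_ge0.
have := ler_wpM2l X0 IH; have := ler_wpM2r Ln BM; rewrite exprS; lra.
Qed.

(** A weighted sum c + la d is a supersolution: with la = 1 / (Y - X^2) it
    grows at most by the factor Y per step as soon as e is small, which bounds
    c.  The bound on c turns the second equation into a linear recurrence with
    a forcing of ratio q Y <= L. *)
Lemma coupled_growth c d e X Y L K q :
  0 <= X -> X ^+ 2 < Y -> 1 < Y -> X ^+ 2 < L -> 0 < q -> q * Y <= L -> 0 <= K -> q < 1 ->
  (forall n, 0 <= e n <= K * q ^+ n) ->
  (forall n, 0 <= c n) -> (forall n, 0 <= d n) ->
  (forall n, c n.+1 = c n + d n + e n * X * c n) ->
  (forall n, d n.+1 = X ^+ 2 * (d n + e n * (1 + X) * c n)) ->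
  exists2 M, 0 <= M & forall n, c n <= M * Y ^+ n /\ d n <= M * L ^+ n.
Proof.
move=> X0 XY Y1 XL q0 qYL K0 q1 eK c0 d0 cS dS.
have Y0 : 0 <= Y by lra.
have L0 : 0 <= L by apply: le_trans (ltW XL); rewrite exprn_ge0.
(* This weight solves 1 + la X^2 = la Y. *)
pose la := (Y - X ^+ 2)^-1.
have la0 : 0 < la by rewrite invr_gt0 subr_gt0.
have laE : 1 + la * X ^+ 2 = la * Y.
  have : la * (Y - X ^+ 2) = 1 by rewrite mulVf// gt_eqF// subr_gt0.
  lra.
pose eta := X + la * X ^+ 2 * (1 + X).
have eta0 : 0 <= eta by rewrite addr_ge0// !mulr_ge0 ?exprn_ge0 ?addr_ge0// ltW.
have [n0 hn0] : exists n0, forall n, (n0 <= n)%N -> e n * eta <= Y - 1.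
  have h : (fun n => q ^+ n * (K * eta)) @ \oo --> (0 * (K * eta)).
    by apply: cvgMr_tmp; apply: cvg_expr; rewrite ger0_norm// ltW.
  rewrite mul0r in h; have Y10 : 0 < Y - 1 by rewrite subr_gt0.
  have [n0 _ hn0] := (cvgrPdist_le _ _).1 h _ Y10.
  exists n0 => n /hn0; rewrite sub0r normrN => /(le_trans (ler_norm _)).
  by apply: le_trans; have /andP[_ he] := eK n; rewrite mulrA [_ * K]mulrC ler_wpM2r.
have [M M0 hM] : exists2 M, 0 <= M & forall n, c n + la * d n <= M * Y ^+ n.
  apply: (@eventually_geometric (fun n => c n + la * d n) Y n0); first by lra.
    by move=> n; rewrite addr_ge0// mulr_ge0// ltW.
  move=> n /hn0 hn; rewrite cS dS.
  have := ler_wpM2r (c0 n) hn; rewrite /eta => h1.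
  have h2 : (1 + la * X ^+ 2) * d n = la * Y * d n by rewrite laE.
  lra.
have hc n : c n <= M * Y ^+ n.
  by apply: le_trans (hM n); rewrite lerDl mulr_ge0// ltW.
pose B := X ^+ 2 * (K * (1 + X) * M).
have B0 : 0 <= B by rewrite !mulr_ge0 ?exprn_ge0 ?addr_ge0.
have [M' M'0 hd] : exists2 M, 0 <= M & forall n, d n <= M * L ^+ n.
  apply: (@geometric_forcing d (X ^+ 2) L B) => // [|n]; first by rewrite exprn_ge0.
  rewrite dS mulrDr lerD2l /B -[leRHS]mulrA ler_wpM2l ?exprn_ge0//.
  have /andP[e0 he] := eK n.
  apply: (@le_trans _ _ (K * q ^+ n * (1 + X) * (M * Y ^+ n))).
    by rewrite ler_pM ?mulr_ge0 ?addr_ge0// ler_wpM2r ?addr_ge0.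
  have -> : K * q ^+ n * (1 + X) * (M * Y ^+ n) = K * (1 + X) * M * (q * Y) ^+ n.
    by rewrite exprMn; ring.
  rewrite ler_wpM2l ?mulr_ge0 ?addr_ge0// lerXn2r ?nnegrE//.
  by rewrite mulr_ge0// ltW.
exists (M + M'); first by rewrite addr_ge0.
move=> n; split; [apply: le_trans (hc n) _|apply: le_trans (hd n) _]; rewrite ler_wpM2r ?exprn_ge0//.
  by rewrite lerDl.
by rewrite lerDr.
Qed.
End RealRecurrence.

(** Up to the factor 1 / prod a_j, this is the Jost function. *)
Definition gcG_lim (R : realType) (a b : nat -> R) (x : Cplx R) : Cplx R :=
  limn (fun n => gcG a b n x).

Section GeronimoCaseBounds.
Variables (R : realType) (a b : nat -> R).
Variables (K q : R).
Hypotheses (K_ge0 : 0 <= K) (q_gt0 : 0 < q) (q_lt1 : q < 1).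
Hypothesis decay : forall n, `|1 - a n ^+ 2| + `|b n| <= K * q ^+ n.
Variables (z0 : Cplx R) (r : R) (x : Cplx R -> Cplx R) (X Y L : R).
Hypothesis r_gt0 : 0 < r.
Hypothesis expands_x : forall M f, expands z0 r M f ->
  expands z0 r (X * M) (fun z => x z * f z).
Hypotheses (X_ge0 : 0 <= X) (X_lt_Y : X ^+ 2 < Y) (Y_gt1 : 1 < Y).
Hypotheses (X_lt_L : X ^+ 2 < L) (qY_le_L : q * Y <= L) (qY_lt1 : q * Y < 1).

Let e n : R := `|1 - a n ^+ 2| + `|b n|.
Let C n z := gcC a b n (x z).
Let G n z := gcG a b n (x z).
Let D n z := G n z - (1 - x z ^+ 2) * C n z.
Let e_ge0 n : 0 <= e n. Proof. by rewrite addr_ge0. Qed.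

(** The estimates are carried out for an abstract x whose multiplication has
    norm at most X, so as to apply to both x = z and x = 1/z. *)
Lemma expands_gc_coefM n M f : expands z0 r M f ->
  expands z0 r (e n * (X ^+ 2 + X) * M) (fun z => gc_coef a b n (x z) * f z).
Proof.
move=> hf; have M0 := expands_ge0 hf.
have h1 := expandsZ (1 - a n ^+ 2)%:C (expands_x (expands_x hf)).
have h2 := expandsZ (- (b n)%:C) (expands_x hf).
have := expandsD r_gt0 h1 h2; rewrite normcN !normc_real => h.
apply: (@expands_le _ _ _ (`|1 - a n ^+ 2| * (X * (X * M)) + `|b n| * (X * M))).
  rewrite /e; have := normr_ge0 (1 - a n ^+ 2); have := normr_ge0 (b n).
  set p := `|_|; set p' := `|_| => p0 p'0.
  rewrite -subr_ge0.
  have -> : (p' + p) * (X ^+ 2 + X) * M - (p' * (X * (X * M)) + p * (X * M)) =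
    p' * (X * M) + p * (X * X * M) by ring.
  by rewrite addr_ge0// !mulr_ge0.
by apply: expands_eq h => z _; rewrite /gc_coef; ring.
Qed.

(** Norms of C_n and of D_n = G_n - (1 - x^2) C_n obey the recursions of
    these functions with every coefficient replaced by its absolute value. *)
Fixpoint majorant n : R * R :=
  if n is m.+1 then
    let: (c, d) := majorant m in
    (c + d + e m * X * c, X ^+ 2 * (d + e m * (1 + X) * c))
  else (1, X ^+ 2).

Let c n := (majorant n).1.
Let d n := (majorant n).2.
Let cS n : c n.+1 = c n + d n + e n * X * c n.
Proof. by rewrite /c /d /=; case: majorant. Qed.
Let dS n : d n.+1 = X ^+ 2 * (d n + e n * (1 + X) * c n).
Proof. by rewrite /c /d /=; case: majorant. Qed.

Lemma expands_majorant n : expands z0 r (c n) (C n) /\ expands z0 r (d n) (D n).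
Proof.
have h1 : expands z0 r 1 (fun=> 1) by have := expands_cst z0 r 1; rewrite normc1.
elim: n => [|n [IHC IHD]].
  split; first by apply: expands_eq h1 => z _.
  have := expands_x (expands_x h1); rewrite mulr1 /d /= expr2.
  by apply: expands_eq => z _; rewrite /D /C /G /gcC /gcG /=; ring.
split.
  have h := expandsZ (- (b n)%:C) (expands_x IHC).
  have := expandsD r_gt0 (expandsD r_gt0 IHC IHD) h.
  rewrite normcN normc_real => h'.
  apply: (@expands_le _ _ _ (c n + d n + `|b n| * (X * c n))).
    rewrite cS lerD2l mulrA !ler_wpM2r ?(expands_ge0 IHC)//.
    by rewrite /e lerDr.
  by apply: expands_eq h' => z _; rewrite /D /C /G gcCS; ring.
have h2 := expandsZ (1 - a n ^+ 2)%:C IHC.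
have h := expandsZ (- (b n)%:C) (expands_x IHC).
have := expands_x (expands_x (expandsD r_gt0 (expandsD r_gt0 IHD h2) h)).
rewrite normcN !normc_real => h'.
apply: (@expands_le _ _ _ (X * (X * (d n + `|1 - a n ^+ 2| * c n + `|b n| * (X * c n))))).
  rewrite dS expr2 -(mulrA X X) !ler_wpM2l// -addrA lerD2l /e.
  have := normr_ge0 (1 - a n ^+ 2); have := normr_ge0 (b n).
  have := expands_ge0 IHC.
  set p := `|_|; set p' := `|_| => c0 p0 p'0.
  rewrite -subr_ge0.
  have -> : (p' + p) * (1 + X) * c n - (p' * c n + p * (X * c n)) =
    p * c n + p' * X * c n by ring.
  by rewrite addr_ge0// !mulr_ge0.
apply: expands_eq h' => z _; rewrite /D /C /G gcGS gcCS /gc_coef; ring.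
Qed.

Lemma majorant_growth : exists2 M, 0 <= M & forall n, c n <= M * Y ^+ n /\ d n <= M * L ^+ n.
Proof.
apply: (@coupled_growth _ c d e X Y L K q) => // n.
- by rewrite e_ge0 decay.
- exact: expands_ge0 (expands_majorant n).1.
- exact: expands_ge0 (expands_majorant n).2.
Qed.

Lemma expands_gcC : exists2 M, 0 <= M & forall n, expands z0 r (M * Y ^+ n) (C n).
Proof.
have [M M0 hM] := majorant_growth; exists M => // n.
exact: expands_le (hM n).1 (expands_majorant n).1.
Qed.

Lemma expands_gc_term : exists2 M, 0 <= M & forall n,
  expands z0 r (M * (q * Y) ^+ n) (fun z => gc_coef a b n (x z) * C n z).
Proof.
have [M M0 hM] := expands_gcC; exists (K * (X ^+ 2 + X) * M).
  by rewrite !mulr_ge0// addr_ge0// exprn_ge0.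
move=> n; apply: expands_le (expands_gc_coefM n (hM n)).
have -> : K * (X ^+ 2 + X) * M * (q * Y) ^+ n = K * q ^+ n * (X ^+ 2 + X) * (M * Y ^+ n).
  by rewrite exprMn; ring.
have Y0 : 0 <= Y := ltW (lt_trans ltr01 Y_gt1).
apply: ler_wpM2r; first by rewrite mulr_ge0 ?exprn_ge0.
by rewrite ler_wpM2r ?decay// addr_ge0// exprn_ge0.
Qed.
Lemma expands_gcG_tail : exists2 M, 0 <= M & forall n,
  expands z0 r (M * (q * Y) ^+ n) (fun z => gcG_lim a b (x z) - G n z) /\
  forall z, normc (z - z0) <= r ->
    (fun n => gcG a b n (x z)) @ \oo --> gcG_lim a b (x z).
Proof.
have [M M0 hM] := expands_gc_term.
have qY1 : `|q * Y| < 1.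
  by rewrite ger0_norm// mulr_ge0 ?(ltW q_gt0)// (ltW (lt_trans ltr01 Y_gt1)).
exists (M / (1 - q * Y)); first by rewrite divr_ge0// subr_ge0 ltW.
move=> n; pose t k z := gc_coef a b (k + n) (x z) * C (k + n) z.
have ht k : expands z0 r (geometric (M * (q * Y) ^+ n) (q * Y) k) (t k).
  by rewrite /geometric /= -mulrA -exprD addnC; exact: hM.
have hS := @cvg_geometric_series R (M * (q * Y) ^+ n) _ qY1.
have lim_t z : normc (z - z0) <= r -> exists2 l, series (t ^~ z) @ \oo --> l &
    (fun m => gcG a b m (x z)) @ \oo --> G n z + l.
  move=> zr.
  have [l [hl _]] := cvg_series_majorant (fun k => expands_norm r_gt0 zr (ht k)) hS.
  exists l; first exact: hl.
  rewrite -(cvg_shiftn n); apply: eq_cvgn (cvgD (cvg_cst (G n z)) hl) => m.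
  rewrite !fctE seriesE; elim: m => [|m IH]; first by rewrite big_ord0 addr0.
  by rewrite big_ord_recr addrA IH /= addSn gcGS.
split.
  have -> : M / (1 - q * Y) * (q * Y) ^+ n = M * (q * Y) ^+ n / (1 - q * Y) by ring.
  apply: expands_eq (expands_series r_gt0 ht hS) => z zr.
  have [l hl hG] := lim_t z zr.
  by rewrite (cvg_lim _ hl)// /gcG_lim (cvg_lim _ hG)// addrC addKr.
move=> z zr; have [l hl hG] := lim_t z zr.
by rewrite /gcG_lim (cvg_lim _ hG).
Qed.

Lemma cvg_gcG z : normc (z - z0) <= r ->
  (fun n => gcG a b n (x z)) @ \oo --> gcG_lim a b (x z).
Proof. by have [M _ /(_ 0)[_]] := expands_gcG_tail; exact. Qed.

Lemma expands_gcG_lim : exists M, expands z0 r M (fun z => gcG_lim a b (x z)).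
Proof.
have [M _ /(_ 0%N)[h _]] := expands_gcG_tail.
exists (normc (1 : Cplx R) + M * (q * Y) ^+ 0).
have := expandsD r_gt0 (expands_cst z0 r 1) h.
by apply: expands_eq => z _; rewrite /G /gcG /= addrC subrK.
Qed.

(** The error splits as (G - G_n) + D_n: the first part is the tail of
    sum d_k C_k, of order (q Y)^n, the second is bounded by the majorant. *)
Lemma expands_gc_error : exists2 M, 0 <= M & forall n, expands z0 r (M * L ^+ n)
  (fun z => gcG_lim a b (x z) - (1 - x z ^+ 2) * gcC a b n (x z)).
Proof.
have [M M0 hM] := expands_gcG_tail; have [M' M'0 hM'] := majorant_growth.
exists (M + M'); first exact: addr_ge0.
move=> n; have hD := expands_le (hM' n).2 (expands_majorant n).2.
have h := expandsD r_gt0 (hM n).1 hD.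
apply: (@expands_le _ _ _ (M * (q * Y) ^+ n + M' * L ^+ n)).
  rewrite mulrDl lerD2r ler_wpM2l// lerXn2r ?nnegrE//.
    by rewrite mulr_ge0 ?(ltW q_gt0)// (ltW (lt_trans ltr01 Y_gt1)).
  by apply: le_trans (ltW X_lt_L); rewrite exprn_ge0.
by apply: expands_eq h => z _; rewrite /D addrA subrK.
Qed.
End GeronimoCaseBounds.

(** * The continued function *)

Section Extension.
Variables (R : realType) (a b : nat -> R).

Definition remainder_term n (z : Cplx R) : Cplx R :=
  gc_coef a b n z * (z ^+ (2 * n + 2) *
    (gcG_lim a b z^-1 - (1 - z^-1 ^+ 2) * gcC a b n z^-1)).

(** The continued function, up to the factor 1 / prod a_j. *)
Definition extension (z : Cplx R) : Cplx R :=
  1 - z ^+ 2 + z ^+ 2 * gcG_lim a b z^-1 + limn (series (remainder_term ^~ z)).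

Variables (K q : R).
Hypotheses (K_ge0 : 0 <= K) (q_gt0 : 0 < q) (q_lt1 : q < 1).
Hypothesis decay : forall n, `|1 - a n ^+ 2| + `|b n| <= K * q ^+ n.
Variables (z0 : Cplx R) (r Z W Y L : R).
Hypotheses (r_gt0 : 0 < r) (r_lt : r < normc z0).
Hypotheses (ZE : Z = normc z0 + r) (WE : W = (normc z0 - r)^-1).
Hypotheses (W_lt_Y : W ^+ 2 < Y) (Y_gt1 : 1 < Y).
Hypotheses (W_lt_L : W ^+ 2 < L) (qY_le_L : q * Y <= L) (qY_lt1 : q * Y < 1).

Let W_ge0 : 0 <= W. Proof. by rewrite WE invr_ge0 subr_ge0 ltW. Qed.
Let Z_ge0 : 0 <= Z. Proof. by rewrite ZE addr_ge0 ?normc_ge0// ltW. Qed.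
Let L_ge0 : 0 <= L. Proof. by apply: le_trans (ltW W_lt_L); rewrite exprn_ge0. Qed.

Let expands_inv M f : expands z0 r M f -> expands z0 r (W * M) (fun z => z^-1 * f z).
Proof. by rewrite WE; exact: expandsV. Qed.
Let expands_id M f : expands z0 r M f -> expands z0 r (Z * M) (fun z => z * f z).
Proof. by rewrite ZE; exact: expandsX. Qed.

(** The decay L^n of the error at 1/z, with L close to max(|z|^-2, q),
    compensates the growth of z^(2n+2). *)
Lemma expands_remainder : exists2 M, 0 <= M & forall n,
  expands z0 r (M * (q * Z ^+ 2 * L) ^+ n) (remainder_term n).
Proof.
have [M M0 hM] := expands_gc_error K_ge0 q_gt0 q_lt1 decay r_gt0 expands_inv
  W_ge0 W_lt_Y Y_gt1 W_lt_L qY_le_L qY_lt1.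
exists (K * (Z ^+ 2 + Z) * Z ^+ 2 * M).
  by rewrite !mulr_ge0 ?addr_ge0 ?exprn_ge0//.
move=> n.
have hX k N f : expands z0 r N f -> expands z0 r (Z ^+ k * N) (fun z => z ^+ k * f z).
  move=> hf; elim: k => [|k IH].
    by rewrite expr0 mul1r; apply: (expands_eq _ hf) => z _; rewrite expr0 mul1r.
  rewrite exprS -mulrA; apply: expands_eq (expands_id IH) => z _.
  by rewrite exprS mulrA.
have h := expands_gc_coefM a b r_gt0 expands_id Z_ge0 n (hX (2 * n + 2)%N _ _ (hM n)).
apply: expands_le h.
have -> : K * (Z ^+ 2 + Z) * Z ^+ 2 * M * (q * Z ^+ 2 * L) ^+ n =
    K * q ^+ n * (Z ^+ 2 + Z) * (Z ^+ (2 * n + 2) * (M * L ^+ n)).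
  by rewrite exprD exprM !exprMn; ring.
apply: ler_wpM2r; first by rewrite !mulr_ge0 ?exprn_ge0.
by apply: ler_wpM2r; rewrite ?addr_ge0 ?exprn_ge0// decay.
Qed.

Lemma expands_extension : q * Z ^+ 2 * L < 1 -> exists M, expands z0 r M extension.
Proof.
move=> qZL; have [M M0 hM] := expands_remainder.
have [N hN] := expands_gcG_lim K_ge0 q_gt0 q_lt1 decay r_gt0 expands_inv
  W_ge0 W_lt_Y Y_gt1 W_lt_L qY_le_L qY_lt1.
have qZL1 : `|q * Z ^+ 2 * L| < 1.
  by rewrite ger0_norm// !mulr_ge0 ?exprn_ge0// ltW.
have hS := expands_series r_gt0 hM (@cvg_geometric_series R M _ qZL1).
have h1 := expands_cst z0 r 1.
have h2 := expands_id (expands_id (expands_cst z0 r (-1))).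
have h3 := expands_id (expands_id hN).
eexists; apply: expands_eq (expandsD r_gt0 (expandsD r_gt0 (expandsD r_gt0 h1 h2) h3) hS).
by move=> z _; rewrite /extension; ring.
Qed.

Lemma B_funE z l : series (fun n => gc_coef a b n z * z ^+ (2 * n)) @ \oo --> l ->
  B_fun a b z = 1 + l.
Proof.
move=> hl; rewrite /B_fun -[l in RHS]opprK; congr (1 - _).
apply: cvg_lim; first exact: norm_hausdorff.
apply: eq_cvgn (cvgN hl) => n; rewrite !fctE !seriesE -sumrN.
apply: eq_bigr => k _; rewrite /gc_coef !rmorphB !rmorph1 !exprD expr1.
by ring.
Qed.

(** Near the unit circle sum d_n C_n(z) and sum d_n z^(2n) converge
    separately, and palindromicity of C_n lets them be recombined. *)
Lemma extensionE z : normc z0 = 1 -> normc (z - z0) <= r ->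
  extension z = (1 - z ^+ 2) * gcG_lim a b z + z ^+ 2 * gcG_lim a b z^-1 * B_fun a b z.
Proof.
move=> z01 zr.
have r1 : r < 1 by rewrite -z01.
have ZW : Z <= W.
  rewrite ZE WE z01 -[leRHS]mul1r ler_pdivlMr ?subr_gt0//.
  have := mulr_ge0 (ltW r_gt0) (ltW r_gt0); lra.
have expands_id' M f : expands z0 r M f -> expands z0 r (W * M) (fun z => z * f z).
  move=> hf; apply: expands_le (expands_id hf).
  by apply: ler_wpM2r => //; exact: expands_ge0 hf.
have zn0 : z != 0.
  apply/eqP => ze; move: zr; rewrite ze sub0r normcN z01; lra.
have [M M0 hM] := expands_gc_term K_ge0 q_gt0 q_lt1 decay r_gt0 expands_id'
  W_ge0 W_lt_Y Y_gt1 W_lt_L qY_le_L.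
have hG := cvg_gcG K_ge0 q_gt0 q_lt1 decay r_gt0 expands_id'
  W_ge0 W_lt_Y Y_gt1 W_lt_L qY_le_L qY_lt1 zr.
have Y0 : 0 <= Y := ltW (lt_trans ltr01 Y_gt1).
have qY1 : `|q * Y| < 1 by rewrite ger0_norm// mulr_ge0// ltW.
have hsG : series (fun n => gc_coef a b n z * gcC a b n z) @ \oo --> gcG_lim a b z - 1.
  apply: eq_cvgn (cvgB hG (cvg_cst (1 : Cplx R))) => n; rewrite !fctE seriesE.
  elim: n => [|n IH]; first by rewrite big_ord0 subrr.
  by rewrite big_ord_recr -IH gcGS /=; ring.
have [l hl] : exists l : Cplx R, series (fun n => gc_coef a b n z * z ^+ (2 * n)) @ \oo --> l.
  have zW : normc z <= W.
    by apply: le_trans ZW; rewrite ZE; have := normcD (z - z0) z0; rewrite subrK; lra.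
  have h n : normc (gc_coef a b n z * z ^+ (2 * n)) <=
      geometric (K * (W ^+ 2 + W)) (q * Y) n.
    have hz : expands z0 r (normc (z ^+ (2 * n))) (fun=> z ^+ (2 * n)) by exact: expands_cst.
    have h := expands_gc_coefM a b r_gt0 expands_id' W_ge0 n hz.
    apply: (le_trans (expands_norm r_gt0 zr h)); rewrite /geometric /=.
    have -> : K * (W ^+ 2 + W) * (q * Y) ^+ n = K * q ^+ n * (W ^+ 2 + W) * Y ^+ n.
      by rewrite exprMn; ring.
    apply: ler_pM.
    - by rewrite mulr_ge0 ?addr_ge0 ?exprn_ge0.
    - exact: normc_ge0.
    - by rewrite ler_wpM2r ?decay// addr_ge0 ?exprn_ge0.
    - rewrite normcX exprM lerXn2r ?nnegrE ?exprn_ge0 ?normc_ge0//.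
      by apply: le_trans (ltW W_lt_Y); rewrite lerXn2r ?nnegrE ?normc_ge0.
  by have [l [hl _]] := cvg_series_majorant h (@cvg_geometric_series R _ _ qY1); exists l.
rewrite (B_funE hl) /extension.
set g := gcG_lim a b z in hsG *; set w := gcG_lim a b z^-1.
have -> : limn (series (remainder_term ^~ z)) = z ^+ 2 * w * l + (1 - z ^+ 2) * (g - 1).
  apply: cvg_lim; first exact: norm_hausdorff.
  apply: eq_cvgn (cvgD (cvgMl_tmp (a := z ^+ 2 * w) hl)
    (cvgMl_tmp (a := 1 - z ^+ 2) hsG)) => n; rewrite !fctE !seriesE !mulr_sumr -big_split /=.
  apply: eq_bigr => k _; rewrite /remainder_term (gcC_palindrome a b k zn0) exprD -/w.
  by field.
by ring.
Qed.
End Extension.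

Section Conjugation.
Variables (R : realType) (a b : nat -> R).

Lemma gcG_conj n (x : Cplx R) : gcG a b n x^* = (gcG a b n x)^*.
Proof.
suff : gcG a b n x^* = (gcG a b n x)^* /\ gcC a b n x^* = (gcC a b n x)^* by case.
elim: n => [|n [IHG IHC]]; first by rewrite /gcG /gcC /= rmorph1.
have conjD (y w : Cplx R) : (y + w)^* = y^* + w^* by exact: rmorphD.
have conjB (y w : Cplx R) : (y - w)^* = y^* - w^* by exact: rmorphB.
have conjM (y w : Cplx R) : (y * w)^* = y^* * w^* by exact: rmorphM.
have conjX (y : Cplx R) k : (y ^+ k)^* = y^* ^+ k by exact: rmorphXn.
rewrite !gcGS !gcCS IHG IHC /gc_coef !(conjD, conjB).
by rewrite ![(_ * gcC a b n x)^*]conjM !conjB ![(_%:C * _)^*]conjM !conjX !conj_real.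
Qed.

Lemma gcG_lim_conj (x : Cplx R) : (fun n => gcG a b n x) @ \oo --> gcG_lim a b x ->
  gcG_lim a b x^* = (gcG_lim a b x)^*.
Proof.
move=> h; apply: cvg_lim; first exact: norm_hausdorff.
apply/cvg_normcP; move/cvg_normcP: h.
by apply: eq_cvgn => n; rewrite gcG_conj -rmorphB normc_conj.
Qed.
End Conjugation.

(** * The identity theorem for power series *)

Section IdentityTheorem.
Variable R : realType.
Implicit Types (z w : Cplx R).

(** By induction on m: once the coefficients below m vanish, d_m w^m s^m is,
    for small s, of order s^(m+1). *)
Lemma power_series_eq0 (d : nat -> Cplx R) (w : Cplx R) (s1 M : R) :
  w != 0 -> 0 < s1 -> (forall N, \sum_(k < N) normc (d k) * (s1 * normc w) ^+ k <= M) ->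
  (forall s : R, 0 < s -> s < s1 ->
     series (fun k => d k * (s%:C * w) ^+ k) @ \oo --> (0 : Cplx R)) ->
  forall m, d m = 0.
Proof.
move=> w0 s10 dM hd; elim/ltn_ind => m IH.
have nw : 0 < normc w by rewrite normc_gt0.
set r := s1 * normc w in dM; have r0 : 0 < r by rewrite mulr_gt0.
have M0 : 0 <= M by have := dM 0%N; rewrite big_ord0.
have key s : 0 < s -> s < s1 -> normc (d m) <= s * (normc w * M / r ^+ m.+1).
  move=> s0 ss1; pose t := s * normc w.
  have t0 : 0 < t by rewrite mulr_gt0.
  have tr : t <= r by rewrite /t /r ler_wpM2r ?normc_ge0// ltW.
  have : normc (0 - d m * (s%:C * w) ^+ m) <= (t / r) ^+ m.+1 * M.
    apply: (le_cvg_normc (cvgB (hd s s0 ss1) (cvg_cst _))).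
    exists m.+1 => // N /= mN; rewrite !fctE seriesE (bigD1 (Ordinal mN)) //=.
    rewrite addrAC subrr add0r; apply: (le_trans (normc_sum _ _ _)).
    apply: (@le_trans _ _ ((t / r) ^+ m.+1 * \sum_(k < N) normc (d k) * r ^+ k)); last first.
      by rewrite ler_wpM2l ?dM// exprn_ge0// divr_ge0// ltW.
    rewrite mulr_sumr big_mkcond /=; apply: ler_sum => k _.
    have rhs0 : 0 <= (t / r) ^+ m.+1 * (normc (d k) * r ^+ k).
      by rewrite !mulr_ge0 ?exprn_ge0 ?normc_ge0 ?divr_ge0// ltW.
    case: ifP => // km; have [km'|mk|km'] := ltngtP k m.
    - by move: rhs0; rewrite IH// mul0r normc0.
    - rewrite normcM normcX normcM normc_real gtr0_norm// -/t mulrCA.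
      rewrite ler_wpM2l ?normc_ge0// expr_div_n mulrAC -mulrA.
      have -> : t ^+ k = t ^+ m.+1 * t ^+ (k - m.+1) by rewrite -exprD subnKC.
      rewrite ler_wpM2l ?exprn_ge0 ?(ltW t0)//.
      rewrite ler_pdivlMr ?exprn_gt0//.
      rewrite (_ : r ^+ k = r ^+ (k - m.+1) * r ^+ m.+1); last by rewrite -exprD subnK.
      by rewrite ler_wpM2r ?exprn_ge0 ?(ltW r0)// lerXn2r ?nnegrE// ltW.
    - by case/eqP: km; apply: val_inj.
  rewrite sub0r normcN normcM normcX normcM normc_real gtr0_norm// -/t => h.
  have tm : 0 < t ^+ m by rewrite exprn_gt0.
  move: h; rewrite -ler_pdivlMr// => /le_trans; apply.
  rewrite le_eqVlt; apply/orP; left; apply/eqP; rewrite /t !exprS.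
  by rewrite expr_div_n; field; rewrite !gt_eqF// ?exprn_gt0.
apply/eqP; rewrite -normc_eq0 eq_le normc_ge0 andbT.
apply/ler_addgt0Pl => e e0; rewrite addr0.
set B := normc w * M / r ^+ m.+1 in key.
have B0 : 0 <= B by rewrite /B divr_ge0 ?mulr_ge0 ?exprn_ge0 ?normc_ge0// ltW.
pose s := Num.min (s1 / 2) (e / (B + 1)).
have s0 : 0 < s by rewrite lt_min !divr_gt0// ltr_wpDl.
have ss1 : s < s1.
  by apply: (@le_lt_trans _ _ (s1 / 2)); [rewrite ge_min lexx|lra].
apply: le_trans (key s s0 ss1) _.
have : s <= e / (B + 1) by rewrite ge_min lexx orbT.
rewrite ler_pdivlMr ?ltr_wpDl// mulrDr mulr1; have := ltW s0; lra.
Qed.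

(** Stated for agreement along a segment ending at z0, as u is only known
    inside the disk and z0 lies on its boundary. *)
Lemma identity_theorem (u f : Cplx R -> Cplx R) z0 w (r M : R) : 0 < r -> w != 0 ->
  analytic_at u z0 -> expands z0 r M f ->
  (forall s : R, 0 < s -> s < 1 -> u (z0 + s%:C * w) = f (z0 + s%:C * w)) ->
  \forall z \near z0, u z = f z.
Proof.
move=> r0 w0 [c /near_normcP[e e0 hc]] [c' [_ hc']] uf.
pose d k := c k - c' k; pose e' := Num.min e r.
have e'0 : 0 < e' by rewrite lt_min e0.
have hd z : normc (z - z0) < e' ->
    series (fun k => d k * (z - z0) ^+ k) @ \oo --> u z - f z.
  rewrite lt_min => /andP[ze zr].
  apply: eq_cvgn (cvgB (hc z ze) (hc' z (ltW zr))) => n.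
  by rewrite !fctE !seriesE -sumrB; apply: eq_bigr => k _; rewrite -mulrBl.
have nw : 0 < normc w by rewrite normc_gt0.
pose s1 := Num.min 1 (e' / (2 * normc w)).
have s10 : 0 < s1 by rewrite lt_min ltr01 divr_gt0// mulr_gt0.
have s1e : s1 * normc w < e'.
  apply: (@le_lt_trans _ _ (e' / 2)); last by lra.
  rewrite -ler_pdivlMr// ge_min; apply/orP; right.
  by rewrite invfM mulrA.
have normsw s : 0 < s -> normc (z0 + s%:C * w - z0) = s * normc w.
  by move=> s0; rewrite addrC addKr normcM normc_real gtr0_norm.
have [A A0 hA] : exists2 A, 0 <= A & forall n, normc (d n) * (s1 * normc w) ^+ n <= A * 1 ^+ n.
  have h := hd (z0 + s1%:C * w); rewrite normsw// in h.
  have /cvg_series_cvg_0 /cvg_normcP : cvgn (series (fun k => d k * (z0 + s1%:C * w - z0) ^+ k)).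
    by apply/cvg_ex; eexists; exact: h.
  move=> /cvgrPdist_le /(_ _ ltr01)[N _ hN].
  exists (1 + \sum_(k < N) normc (d k) * (s1 * normc w) ^+ k).
    by rewrite addr_ge0// sumr_ge0// => k _; rewrite mulr_ge0 ?normc_ge0// exprn_ge0// mulr_ge0// ltW.
  move=> n; rewrite expr1n mulr1; case: (ltnP n N) => [nN|/hN].
    rewrite (bigD1 (Ordinal nN)) //= addrCA lerDl addr_ge0// sumr_ge0// => k _.
    by rewrite mulr_ge0 ?normc_ge0// exprn_ge0// mulr_ge0// ltW.
  rewrite sub0r normrN ger0_norm ?normc_ge0// subr0 normcM normcX normsw//.
  move=> /le_trans; apply; rewrite lerDl sumr_ge0// => k _.
  by rewrite mulr_ge0 ?normc_ge0// exprn_ge0// mulr_ge0// ltW.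
have d0 : forall m, d m = 0.
  apply: (@power_series_eq0 d w (s1 / 2) (A * 2)) => //; first by rewrite divr_gt0.
    move=> N; have half : (2^-1 : R) != 1 by lra.
    apply: (@le_trans _ _ (series (geometric A 2^-1) N)).
      rewrite seriesE; apply: ler_sum => k _; rewrite /geometric /=.
      rewrite mulrAC exprMn mulrA ler_wpM2r ?exprn_ge0 ?invr_ge0//.
      by have := hA k; rewrite expr1n mulr1.
    rewrite geometric_seriesE//=.
    have : 0 <= A * 2^-1 ^+ N by rewrite mulr_ge0// exprn_ge0// invr_ge0.
    have -> : (1 - 2^-1 : R) = 2^-1 by lra.
    by rewrite invrK; lra.
  move=> s s0 ss1.
  have s11 : s < s1 by lra.
  have s1' : s < 1 by apply: lt_le_trans s11 _; rewrite ge_min lexx.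
  have := hd (z0 + s%:C * w); rewrite normsw// uf// subrr.
  have -> : z0 + s%:C * w - z0 = s%:C * w by rewrite addrC addKr.
  by apply; apply: le_lt_trans s1e; rewrite ler_wpM2r ?normc_ge0// ltW.
apply/near_normcP; exists e' => // z /hd h.
apply/eqP; rewrite -subr_eq0; apply/eqP.
have h0 : series (fun k => d k * (z - z0) ^+ k) @ \oo --> (0 : Cplx R).
  apply: eq_cvgn (cvg_cst _) => n; rewrite seriesE big1// => k _.
  by rewrite d0 mul0r.
exact: (cvg_unique _ h h0).
Qed.
End IdentityTheorem.

(** * Choice of the radii, and the Jost function as a limit *)

Section Radii.
Variable R : realType.
Implicit Types (t s q : R).

Lemma radius_between t s : 0 <= t -> t < 1 -> t < s -> t ^+ 2 * s < 1 ->
  exists p : R, [/\ t < p, p < 1, p < s & p ^+ 2 * s < 1].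
Proof.
move=> t0 t1 ts t2s; have s0 : 0 < s by exact: le_lt_trans ts.
(* The condition p^2 s < 1 reads p < (1/s)^(1/2). *)
pose m := Num.min 1 (Num.min s (Num.sqrt s^-1)).
have tm : t < m.
  rewrite !lt_min t1 ts /= -[t]ger0_norm// -sqrtr_sqr ltr_sqrt ?invr_gt0//.
  by rewrite -[s^-1]mul1r ltr_pdivlMr.
have pm : (t + m) / 2 < m by lra.
have tp : t < (t + m) / 2 by lra.
move: pm tp; set p := (_ / _); rewrite !lt_min => /and3P[p1 ps psq] tp.
exists p; split=> //; rewrite -ltr_pdivlMr// mul1r -[s^-1]sqr_sqrtr ?invr_ge0 ?ltW//.
rewrite ltrXn2r// ?nnegrE ?sqrtr_ge0//; lra.
Qed.

(** For s = |z0| and r -> 0 the constraints read max(1, 1/s^2) < Y < 1/q and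
    max(1/s^2, q Y) < L < 1/(q s^2), which are compatible under the hypotheses
    on q; they are open conditions, so a small positive r preserves them. *)
Lemma radii_exist s q : 0 < s -> 0 < q -> q < 1 -> q < s ^+ 2 -> q ^+ 2 * s ^+ 2 < 1 ->
  exists r Y L : R, [/\ 0 < r < s, (s - r)^-1 ^+ 2 < Y, 1 < Y &
    [/\ (s - r)^-1 ^+ 2 < L, q * Y <= L, q * Y < 1 & q * (s + r) ^+ 2 * L < 1]].
Proof.
move=> s0 q0 q1 qs q2s.
have v0 : 0 < s ^+ 2 by rewrite exprn_gt0.
have qv0 : 0 < q * s ^+ 2 by rewrite mulr_gt0.
have q2v0 : 0 < q * (q * s ^+ 2) by rewrite mulr_gt0.
have vV : (s ^+ 2)^-1 * s ^+ 2 = 1 by rewrite mulVf// gt_eqF.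
have [Y [Y1 Yv qY qY2]] : exists Y, [/\ 1 < Y, (s ^+ 2)^-1 < Y, q * Y < 1 &
    q * Y < (q * s ^+ 2)^-1].
  pose lo := Num.max 1 (s ^+ 2)^-1; pose hi := Num.min q^-1 (q * (q * s ^+ 2))^-1.
  have lohi : lo < hi.
    rewrite lt_min !gt_max; apply/andP; split; apply/andP; split.
    - by rewrite invf_gt1.
    - by rewrite ltf_pV2// ?posrE.
    - by rewrite invf_gt1// mulrA -expr2.
    - rewrite ltf_pV2 ?posrE// mulrA -[ltRHS]mul1r ltr_pM2r//.
      by rewrite -expr2 expr_lt1// ltW.
  have h1 : lo < (lo + hi) / 2 by lra.
  have h2 : (lo + hi) / 2 < hi by lra.
  move: h1 h2; set Y := (_ / _); rewrite lt_min !gt_max => /andP[a1 a2] /andP[a3 a4].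
  exists Y; split=> //; first by rewrite mulrC -ltr_pdivlMr// mul1r.
  by rewrite mulrC -ltr_pdivlMr// [ltRHS]mulrC -invfM.
have [L [Lv LY qL]] : exists L, [/\ (s ^+ 2)^-1 < L, q * Y < L & q * s ^+ 2 * L < 1].
  pose lo := Num.max (s ^+ 2)^-1 (q * Y); pose hi := (q * s ^+ 2)^-1.
  have lohi : lo < hi.
    rewrite gt_max qY2 andbT ltf_pV2 ?posrE// -[ltRHS]mul1r ltr_pM2r//.
  have h1 : lo < (lo + hi) / 2 by lra.
  have h2 : (lo + hi) / 2 < hi by lra.
  move: h1 h2; set L := (_ / _); rewrite !gt_max => /andP[a1 a2] a3.
  by exists L; split=> //; rewrite mulrC -ltr_pdivlMr// mul1r.
have id0 : (fun r : R => r) @ 0^'+ --> (0 : R) by apply: cvg_at_right_filter; exact: cvg_id.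
have cW : (fun r : R => (s - r)^-1 * (s - r)^-1) @ 0^'+ --> (s - 0)^-1 * (s - 0)^-1.
  have sr : (fun r : R => (s - r)^-1) @ 0^'+ --> (s - 0)^-1.
    apply: cvgV; first by rewrite subr0 gt_eqF.
    exact: (cvgB (cvg_cst _) id0).
  exact: (cvgM sr sr).
have cZ : (fun r : R => q * ((s + r) * (s + r)) * L) @ 0^'+ --> q * ((s + 0) * (s + 0)) * L.
  have sr : (fun r : R => s + r) @ 0^'+ --> s + 0 by exact: (cvgD (cvg_cst _) id0).
  exact: (cvgMr_tmp (cvgMl_tmp (cvgM sr sr))).
rewrite !subr0 -expr2 exprVn in cW; rewrite !addr0 -expr2 in cZ.
have hY : \forall r \near 0^'+, (s - r)^-1 * (s - r)^-1 < Y by exact: cvgr_lt cW _ Yv.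
have hL : \forall r \near 0^'+, (s - r)^-1 * (s - r)^-1 < L by exact: cvgr_lt cW _ Lv.
have hZ : \forall r \near 0^'+, q * ((s + r) * (s + r)) * L < 1 by exact: cvgr_lt cZ _ qL.
have hp : \forall r \near 0^'+, 0 < r :> R by exact: nbhs_right_gt.
have hs : \forall r \near 0^'+, r < s :> R by exact: nbhs_right_lt.
have [r [h1 h2 h3 h4 h5]] : exists r : R, [/\ (s - r)^-1 * (s - r)^-1 < Y,
    (s - r)^-1 * (s - r)^-1 < L, q * ((s + r) * (s + r)) * L < 1, 0 < r & r < s].
  near (0 : R)^'+ => r; exists r; split; near: r;
    [exact: hY|exact: hL|exact: hZ|exact: hp|exact: hs].
exists r, Y, L; rewrite !expr2; split=> //; first by rewrite h4.
by split=> //; exact: ltW.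
Unshelve. all: by end_near.
Qed.
End Radii.

Section Decay.
Variable R : realType.

(** The root test: beyond some rank e_n < p^(2n+2), and the constant K
    absorbs the finitely many remaining terms. *)
Lemma limn_esup_decay (e : nat -> R) (p : R) : (forall n, 0 <= e n) -> p < 1 ->
  (limn_esup (fun n : nat => (e n `^ (((2 * n.+1)%N)%:R^-1))%:E) < p%:E)%E ->
  exists2 K, 0 <= K & forall n, e n <= K * (p ^+ 2) ^+ n.
Proof.
move=> e0 p1 /ereal_inf_lt[y [A [N _ NA] <-] Ap].
have hN n : (N <= n)%N -> e n `^ (((2 * n.+1)%N)%:R^-1) < p.
  move=> Nn; rewrite -lte_fin; apply: le_lt_trans Ap; apply: ereal_sup_ubound.
  by exists n => //; exact: NA.
have p0 : 0 < p by apply: le_lt_trans (hN N (leqnn N)); exact: powR_ge0.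
have hp n : (N <= n)%N -> e n <= (p ^+ 2) ^+ n.
  move=> /hN h; have -> : e n = (e n `^ (((2 * n.+1)%N)%:R^-1)) ^+ (2 * n.+1).
    by rewrite -powR_mulrn ?powR_ge0// -powRrM mulVf ?powRr1// pnatr_eq0.
  apply: (@le_trans _ _ (p ^+ (2 * n.+1))).
    by rewrite lerXn2r ?nnegrE ?powR_ge0// ltW.
  by rewrite -exprM; apply: ler_wiXn2l; [exact: ltW..|lia].
have pn n : 0 < (p ^+ 2) ^+ n by rewrite !exprn_gt0.
exists (1 + \sum_(k < N) e k / (p ^+ 2) ^+ k).
  by rewrite addr_ge0// sumr_ge0// => k _; rewrite divr_ge0// ltW.
move=> n; case: (ltnP n N) => [nN|/hp h].
  rewrite -ler_pdivrMr// (bigD1 (Ordinal nN)) //= addrCA lerDl addr_ge0// sumr_ge0// => k _.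
  by rewrite divr_ge0// ltW.
apply: (le_trans h); rewrite -[leLHS]mul1r ler_wpM2r ?(ltW (pn n))// lerDl.
by rewrite sumr_ge0// => k _; rewrite divr_ge0// ltW.
Qed.

Lemma limn_esup_ge0 (e : nat -> \bar R) : (forall n, 0 <= e n)%E -> (0 <= limn_esup e)%E.
Proof.
move=> e0; apply: le_ereal_inf_tmp => y [A [N _ NA] <-].
by apply: (le_trans (e0 N)); apply: ereal_sup_ubound; exists N => //; exact: NA (leqnn N).
Qed.
End Decay.

Section JostFunction.
Variables (R : realType) (a b : nat -> R) (K q : R).
Hypotheses (a_gt0 : forall n, 0 < a n).
Hypotheses (K_ge0 : 0 <= K) (q_gt0 : 0 < q) (q_lt1 : q < 1).
Hypothesis decay : forall n, `|1 - a n ^+ 2| + `|b n| <= K * q ^+ n.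

(** The minors differ from G_(n+1) by (a_n^2 - a_n) z^2 C_n, which tends to 0
    because a_n tends to 1 geometrically while C_n grows arbitrarily slowly. *)
Lemma fredholm_det_gcG_lim (z : Cplx R) : z != 0 -> normc z < 1 ->
  fredholm_det (fun v => delta_jacobi a b (resolvent (@free_jacobi R) (z + z^-1) v)) =
  gcG_lim a b z.
Proof.
move=> z0 z1; pose r := 1 - normc z; have r0 : 0 < r by rewrite subr_gt0.
(* On |x| <= 1 the growth rate Y may be any number in ]1, 1/q[. *)
pose Y := (1 + q^-1) / 2.
have qV : 1 < q^-1 by rewrite invf_gt1.
have Y1 : 1 < Y by rewrite /Y; lra.
have qqV : q * q^-1 = 1 by rewrite divff// gt_eqF.
have qY : q * Y < 1 by move: q_lt1 qqV; rewrite /Y; lra.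
have qYY : q * Y <= Y by rewrite ger_pMl ?(lt_trans ltr01 Y1)// ltW.
have X1Y : 1 ^+ 2 < Y by rewrite expr1n.
have expands_id M f : expands z r M f -> expands z r (1 * M) (fun x => x * f x).
  move=> hf; apply: expands_le (expandsX r0 hf).
  by rewrite /r addrC subrK.
have zr : normc (z - z) <= r by rewrite subrr normc0 ltW.
have hG := cvg_gcG K_ge0 q_gt0 q_lt1 decay r0 expands_id ler01 X1Y Y1 X1Y qYY qY zr.
have [M M0 hM] := expands_gcC K_ge0 q_gt0 q_lt1 decay r0 expands_id ler01 X1Y Y1 X1Y qYY.
have qY1 : `|q * Y| < 1 by rewrite ger0_norm// mulr_ge0 ?(ltW q_gt0)// (ltW (lt_trans ltr01 Y1)).
have small : (fun n => ((a n ^+ 2 - a n)%:C * z ^+ 2 * gcC a b n z)) @ \oo --> (0 : Cplx R).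
  apply/cvg_normcP.
  have h : (fun n => K * M * (q * Y) ^+ n) @ \oo --> (K * M * 0 : R).
    by apply: cvgMl_tmp; exact: cvg_expr.
  rewrite mulr0 in h; apply: (squeeze_cvgr _ (cvg_cst (0 : R)) h).
  apply: nearW => n; rewrite normc_ge0 /= subr0 normcM [normc (_%:C * _)]normcM normc_real normcX.
  have -> : K * M * (q * Y) ^+ n = K * q ^+ n * 1 * (M * Y ^+ n) by rewrite exprMn; ring.
  apply: ler_pM; rewrite ?mulr_ge0 ?normc_ge0 ?exprn_ge0//.
  - apply: ler_pM; rewrite ?exprn_ge0 ?normc_ge0//.
      apply: le_trans (decay n); apply: (@le_trans _ _ `|1 - a n ^+ 2|); last by rewrite lerDl.
      have -> : a n ^+ 2 - a n = - (a n * (1 - a n)) by ring.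
      have -> : 1 - a n ^+ 2 = (1 + a n) * (1 - a n) by ring.
      have an := a_gt0 n.
      rewrite normrN !normrM ler_wpM2r// !gtr0_norm//; lra.
    by rewrite exprn_ile1 ?normc_ge0// ltW.
  - by have := expands_norm r0 zr (hM n).
have hG1 : (fun n => gcG a b n.+1 z) @ \oo --> gcG_lim a b z.
  by move: hG; rewrite -cvg_shiftS; apply: eq_cvgn => n.
pose D n : Cplx R := \det (1%:M + \matrix_(i < n, j < n)
  delta_jacobi a b (resolvent (@free_jacobi R) (z + z^-1) (@basis_vec R j)) i).
have hD : D @ \oo --> gcG_lim a b z.
  rewrite -cvg_shiftS -[gcG_lim a b z]addr0; apply: eq_cvgn (cvgD hG1 small) => n.
  by rewrite /D /= fredholm_minor// !fctE gcGE rmorphB; ring.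
exact: (cvg_lim _ hD).
Qed.
End JostFunction.

(** * Behaviour on the unit circle and the theorem *)

(** Reflection in the unit circle fixes z0, and is Lipschitz near it. *)
Lemma near_inv_conj (R : realType) (z0 : Cplx R) (P : Cplx R -> Prop) :
  normc z0 = 1 -> (\forall z \near z0, P z) -> \forall z \near z0, P (z^*)^-1.
Proof.
move=> z01 /near_normcP[e e0 He]; apply/near_normcP.
exists (Num.min 2^-1 (e / 2)); first by rewrite lt_min invr_gt0 ltr0n divr_gt0.
move=> z; rewrite lt_min => /andP[z_half ze]; apply: He.
have z0K : z0^* * z0 = 1 by rewrite mulrC -normCK normE z01 expr1n.
have nz : 2^-1 < normc z.
  have := normcD (z0 - z) z; rewrite subrK z01 normcC; lra.
have zn0 : z^* != 0 by rewrite -normc_gt0 normc_conj; lra.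
have -> : (z^*)^-1 - z0 = (z^*)^-1 * (z0 - z)^* * z0.
  have -> : (z0 - z)^* = z0^* - z^* by exact: rmorphB.
  by rewrite mulrBr mulVf// mulrBl mul1r -mulrA z0K mulr1.
rewrite !normcM normcV !normc_conj z01 mulr1 mulrC ltr_pdivrMr; last by lra.
rewrite normcC; apply: (lt_trans ze); rewrite ltr_pM2l//.
Qed.

Theorem theorem1p5 (R : realType) (a b : nat -> R) (rad : \bar R)
    (u : Cplx R -> Cplx R)
    (a_gt0 : forall n, 0 < a n)
    (rad_limsup :
      (limn_esup (fun n : nat =>
         ((`|a n ^+ 2 - 1| + `|b n|) `^ (((2 * n.+1)%N)%:R^-1))%:E)
       = rad^-1)%E)
    (rad_lt1 : (rad^-1 < 1)%E)
    (u_jost : is_jost_function a b u) :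
  exists F : Cplx R -> Cplx R,
    (forall z : Cplx R,
       (rad^-1 < (Normc.normc z)%:E)%E -> ((Normc.normc z)%:E < rad ^+ 2)%E ->
       analytic_at F z) /\
    (forall z0 : Cplx R, Normc.normc z0 = 1 ->
       \forall z \near z0,
         F z = (1 - z ^+ 2) * u z
               + z ^+ 2 * (u (z^*)^-1)^* * B_fun a b z).
Proof.
have [u_analytic u_det] := u_jost.
pose kappa : R := (limn (fun n : nat => \prod_(j < n) a j))^-1.
have rad_ge0 : (0 <= rad^-1)%E.
  by rewrite -rad_limsup; apply: limn_esup_ge0 => n; rewrite lee_fin powR_ge0.
have [t tE] : exists t : R, (rad^-1 = t%:E)%E.
  by case: (rad^-1)%E rad_ge0 rad_lt1 => // t _ _; exists t.
have t0 : 0 <= t by rewrite -lee_fin -tE.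
have t1 : t < 1 by rewrite -lte_fin -tE.
have decay p : t < p -> p < 1 -> exists2 K, 0 <= K &
    forall n, `|1 - a n ^+ 2| + `|b n| <= K * (p ^+ 2) ^+ n.
  move=> tp p1.
  have lim_lt : (limn_esup (fun n : nat =>
      ((`|a n ^+ 2 - 1| + `|b n|) `^ (((2 * n.+1)%N)%:R^-1))%:E) < p%:E)%E.
    by rewrite rad_limsup tE lte_fin.
  have e_ge0 n : 0 <= `|a n ^+ 2 - 1| + `|b n| by rewrite addr_ge0.
  have [K K0 hK] := limn_esup_decay e_ge0 p1 lim_lt.
  by exists K => // n; rewrite distrC.
have params z : t < normc z -> t ^+ 2 * normc z < 1 -> exists K q r Y L : R,
    [/\ 0 <= K, 0 < q < 1, 0 < r < normc z &
      forall n, `|1 - a n ^+ 2| + `|b n| <= K * q ^+ n] /\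
    [/\ (normc z - r)^-1 ^+ 2 < Y, 1 < Y, (normc z - r)^-1 ^+ 2 < L &
      [/\ q * Y <= L, q * Y < 1 & q * (normc z + r) ^+ 2 * L < 1]].
  move=> tz t2z; have [p [tp p1 pz p2z]] := radius_between t0 t1 tz t2z.
  have p0 : 0 < p by exact: le_lt_trans tp.
  have nz0 : 0 < normc z by exact: lt_trans pz.
  have [K K0 hK] := decay p tp p1.
  have [||||r [Y [L [hr hY Y1 hL]]]] := @radii_exist R (normc z) (p ^+ 2) nz0.
  - by rewrite exprn_gt0.
  - by rewrite expr_lt1// ltW.
  - by rewrite ltrXn2r// ?nnegrE ltW.
  - by rewrite -exprMn expr_lt1// mulr_ge0 ?exprn_ge0 ?ltW.
  exists K, (p ^+ 2), r, Y, L; split; last by case: hL => ? ? ? ?; split.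
  by split=> //; rewrite exprn_gt0// expr_lt1// ltW.
exists (fun z => kappa%:C * extension a b z); split.
  move=> z; rewrite tE lte_fin => tz z_rad.
  have t2z : t ^+ 2 * normc z < 1.
    have [->|tn0] := eqVneq t 0; first by rewrite expr0n mul0r.
    have tp : 0 < t by rewrite lt_def tn0.
    move: z_rad; rewrite -[rad]inveK tE inver (negbTE tn0) -EFin_expe lte_fin => h.
    by rewrite mulrC -ltr_pdivlMr ?exprn_gt0// mul1r -exprVn.
  have [K [q [r [Y [L [[K0 /andP[q0 q1] /andP[r0 rz] hK] [hY Y1 hL [qYL qY1 qZL]]]]]]]] :=
    params z tz t2z.
  have [M hM] := expands_extension K0 q0 q1 hK r0 rz erefl erefl hY Y1 hL qYL qY1 qZL.
  exact: (expands_analytic r0 (expandsZ kappa%:C hM)).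
move=> z0 z01.
have tz0 : t < normc z0 by rewrite z01.
have t2z0 : t ^+ 2 * normc z0 < 1 by rewrite z01 mulr1 expr_lt1.
have [K [q [r [Y [L [[K0 /andP[q0 q1] /andP[r0 rz] hK] [hY Y1 hL [qYL qY1 _]]]]]]]] :=
  params z0 tz0 t2z0.
have W0 : 0 <= (normc z0 - r)^-1 by rewrite invr_ge0 subr_ge0 ltW.
have expands_id M f : expands z0 r M f ->
    expands z0 r ((normc z0 - r)^-1 * M) (fun z => z * f z).
  move=> hf; apply: expands_le (expandsX r0 hf).
  apply: ler_wpM2r; first exact: expands_ge0 hf.
  rewrite z01 in rz *; rewrite -[leRHS]mul1r ler_pdivlMr ?subr_gt0//.
  have := mulr_ge0 (ltW r0) (ltW r0); lra.
have expands_inv M f : expands z0 r M f ->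
  expands z0 r ((normc z0 - r)^-1 * M) (fun z => z^-1 * f z) by exact: expandsV.
have [M hM] := expands_gcG_lim K0 q0 q1 hK r0 expands_id W0 hY Y1 hL qYL qY1.
have z0n0 : z0 != 0 by rewrite -normc_gt0 z01.
have u_eq : \forall z \near z0, u z = kappa%:C * gcG_lim a b z.
  apply: (@identity_theorem _ _ _ z0 (- z0) r _ r0 _ _ (expandsZ kappa%:C hM)).
  - by rewrite oppr_eq0.
  - by apply: u_analytic; rewrite z01.
  move=> s s0 s1.
  have nE : normc (z0 + s%:C * - z0) = 1 - s.
    have -> : z0 + s%:C * - z0 = (1 - s)%:C * z0 by rewrite rmorphB rmorph1; ring.
    by rewrite normcM normc_real z01 mulr1 ger0_norm// subr_ge0 ltW.
  have n0 : z0 + s%:C * - z0 != 0 by rewrite -normc_gt0 nE subr_gt0.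
  have n1 : normc (z0 + s%:C * - z0) < 1 by rewrite nE; lra.
  by rewrite u_det// (fredholm_det_gcG_lim a_gt0 K0 q0 q1 hK n0 n1).
have near_r : \forall z \near z0, normc (z - z0) <= r.
  by apply/near_normcP; exists r => // z /ltW.
apply: filterS3 u_eq (near_inv_conj z01 u_eq) near_r => z -> -> zr.
rewrite (extensionE K0 q0 q1 hK r0 rz erefl erefl hY Y1 hL qYL qY1 z01 zr).
have hinv := cvg_gcG K0 q0 q1 hK r0 expands_inv W0 hY Y1 hL qYL qY1 zr.
have -> : (kappa%:C * gcG_lim a b (z^*)^-1)^* = kappa%:C * gcG_lim a b z^-1.
  have -> : (z^*)^-1 = (z^-1)^* by rewrite fmorphV.
  rewrite (gcG_lim_conj hinv); transitivity (kappa%:C^* * ((gcG_lim a b z^-1)^*)^*).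
    exact: rmorphM.
  by rewrite conj_real conjCK.
ring.
Qed.
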